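(* Let $M$ be a unicyclic gridding matrix. Then $\mathsf{Grid}(M)$ is finitely based.
   Context: Permutations are identified with their plots; $\sigma\le\pi$ if $\pi$ has a subsequence order-isomorphic to $\sigma$. A permutation class is a containment-closed set of permutations; its basis is the set of containment-minimal permutations not in the class, and the class is finitely based if its basis is finite. A gridding matrix is a matrix with entries in $\{0,1,-1\}$; an $m\times n$ one has $m$ columns and $n$ rows, $M_{ij}$ being in column $i$ from the left and row $j$ from the bottom. An $M$-gridding of a permutation $\pi$ of length $L$ is a choice of vertical lines $\tfrac12=v_0\le\dots\le v_m=L+\tfrac12$ and horizontal lines $\tfrac12=h_0\le\dots\le h_n=L+\tfrac12$, not through points of $\pi$, such that for each cell $C_{ij}=\{v_{i-1}<x<v_i,\ h_{j-1}<y<h_j\}$ the points of $\pi$ in it are absent if $M_{ij}=0$, increasing if $M_{ij}=1$, decreasing if $M_{ij}=-1$. $\mathsf{Grid}(M)$ is the class of permutations with an $M$-gridding. The row-column graph $G_M$ is the bipartite graph on $\{1,\dots,m\}\cup\{1',\dots,n'\}$ with edge $ij'$ iff $M_{ij}\neq0$. $M$ is unicyclic if $G_M$ contains exactly one cycle. *)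

(* Defs.v *)
From mathcomp Require Import all_boot all_order all_algebra.
Set Implicit Arguments. Unset Strict Implicit. Unset Printing Implicit Defensive.
Import GRing.Theory Num.Theory.

(* Permutations of length L are sequences of naturals that are a rearrangement
   of 0..L-1; position x (0-based) carries value nth 0 s x (0-based).  The
   plot point is (x+1, s_x + 1). *)
Definition is_perm (s : seq nat) : Prop := perm_eq s (iota 0 (size s)).

Definition order_iso (s u : seq nat) : Prop :=
  size s = size u /\
  forall i j, i < size s -> j < size s ->
    (nth 0 s i < nth 0 s j) = (nth 0 u i < nth 0 u j).

Definition contained (sigma pi : seq nat) : Prop :=
  exists u, subseq u pi /\ order_iso sigma u.

Definition perm_class (C : seq nat -> Prop) : Prop :=
  (forall pi, C pi -> is_perm pi) /\
  (forall sigma pi, is_perm sigma -> contained sigma pi -> C pi -> C sigma).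

Definition basis (C : seq nat -> Prop) (pi : seq nat) : Prop :=
  is_perm pi /\ ~ C pi /\
  (forall sigma, is_perm sigma -> contained sigma pi -> sigma <> pi -> C sigma).

Definition finitely_based (C : seq nat -> Prop) : Prop :=
  exists B : seq (seq nat), forall pi, basis C pi -> pi \in B.

(* A gridding matrix with m columns and n rows: M i j is the entry in column i
   (from the left, 0-based) and row j (from the bottom, 0-based). *)
Definition gridding_matrix (m n : nat) (M : 'I_m -> 'I_n -> int) : Prop :=
  forall i j, M i j \in [:: 0%R; 1%R; (-1)%R].

(* Grid lines: the vertical line v_k = (v k) + 1/2 and horizontal line
   h_k = (h k) + 1/2, with v k, h k natural numbers; lines at half-integers are
   exactly the lines not through points.  Point at position x (0-based, plot
   abscissa x+1) lies in column i (0-based) iff v i <= x < v (i+1). *)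
Definition gridding (m n : nat) (M : 'I_m -> 'I_n -> int) (p : seq nat)
    (v h : nat -> nat) : Prop :=
  let L := size p in
  [/\ v 0 = 0, v m = L & (forall k, k < m -> v k <= v k.+1)] /\
  [/\ h 0 = 0, h n = L & (forall k, k < n -> h k <= h k.+1)] /\
      (forall (i : 'I_m) (j : 'I_n),
        let inC x := (x < L) && (v i <= x < v i.+1) &&
                     (h j <= nth 0 p x < h j.+1) in
        [/\ M i j = 0%R -> forall x, ~~ inC x,
            M i j = 1%R -> forall x y, inC x -> inC y -> x < y ->
                                       nth 0 p x < nth 0 p y &
            M i j = (-1)%R -> forall x y, inC x -> inC y -> x < y ->
                                       nth 0 p x > nth 0 p y]).

Definition Grid (m n : nat) (M : 'I_m -> 'I_n -> int) (p : seq nat) : Prop :=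
  is_perm p /\ exists v h, gridding M p v h.

Definition rc_adj (m n : nat) (M : 'I_m -> 'I_n -> int) : rel ('I_m + 'I_n) :=
  fun a b => match a, b with
             | inl i, inr j => M i j != 0%R
             | inr j, inl i => M i j != 0%R
             | _, _ => false
             end.

(* A cycle of a simple graph, identified with its edge set (edges being
   2-element vertex sets): the edge set of a closed walk through >= 3
   distinct vertices. *)
Definition is_graph_cycle (T : finType) (e : rel T) (C : {set {set T}}) : Prop :=
  exists p : seq T, [/\ uniq p, 3 <= size p, cycle e p &
                        C = [set [set x; next p x] | x in p]].

Definition unicyclic (m n : nat) (M : 'I_m -> 'I_n -> int) : Prop :=
  exists C, is_graph_cycle (rc_adj M) C /\
            forall C', is_graph_cycle (rc_adj M) C' -> C' = C.

(* Main.v *)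
(* If there are infinitely many basis elements, take basis elements pi_k of length > k and, for
   each point d of pi_k, a gridding of pi_k minus d.  For an ultrafilter on the pairs (k, d) that
   makes d differ from every function of k, the grid lines become cuts of the ultraproduct of the
   pi_k for which every internal point is gridded correctly.  It suffices to move all cuts
   slightly so that they become internal.  By overspill this is only obstructed where two
   external cuts, a vertical and a horizontal one, are approached from two opposite quadrants
   by a monotone sequence of points, which they then have to follow; then the two cells in
   these quadrants are nonzero.  If these crossings form a forest, the cuts can be
   moved one after the other.  Otherwise the double cover of the crossing graph, whose vertices
   are the sides of the cuts, maps to subgraphs of minimum degree 2 of the row-column graph.
   When the latter has a unique cycle, both sides of some cut are in the same component, and
   following the curves around maps each side of this cut internally to its other side, so that
   the cut was internal. *)
Require Import Defs.
From mathcomp Require Import all_boot all_order all_algebra.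
From mathcomp Require Import zify boolp filter.
Set Implicit Arguments. Unset Strict Implicit. Unset Printing Implicit Defensive.


(** The gridding of [pi_k] minus [d] depends on [d], so the cuts are functions of the pair, while
    the points that are quantified over are functions of [k] alone. If the cuts too were functions
    of [k] alone, they would grid some [pi_k], which is not in the class; so externality of the cuts
    is the whole difficulty. Almost all requirements on the cuts are open: they hold for every
    choice of internal lines from internal intervals around the cuts. The exception is a monotone
    chain through a crossing, which both lines have to divide at the same place. Through such a tie
    one line determines the other. This is harmless along a forest, but around a closed walk of ties
    the line that comes out need not be the line that went in. A closed walk that exchanges the two
    sides of an external line cannot exist: comparing a position with its image would tell on which
    side it lies, and so define the line internally. It therefore suffices to find such a walk in
    every family of lines each of which crosses two others. *)

(** * Subgraphs of minimum degree 2 in a graph with a unique cycle *)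

Section LongestPath.
Variables (T : finType) (g : rel T).
Hypotheses (gsym : symmetric g) (girr : irreflexive g).

(** A neighbour of [z] on the path beyond its second vertex would close an initial segment of the
    path into a cycle. *)
Lemma front_neighbor_unique z q :
  (forall p, uniq p -> 3 <= size p -> ~~ cycle g p) ->
  uniq (z :: q) -> path g z q -> (forall w, g z w -> w \in z :: q) ->
  forall w w', g z w -> g z w' -> w = w'.
Proof.
move=> acyc uq pq nbr.
suff head w : g z w -> w = head z q by move=> w w' /head -> /head ->.
move=> gzw; have := nbr _ gzw; rewrite inE => /orP[/eqP wz|].
  by rewrite wz girr in gzw.
case: q uq pq {nbr} => [|b q] //= uq pq; rewrite inE => /orP[/eqP//|wq].
case/splitPr: wq uq pq => q1 q2 uq pq.
suff: cycle g (z :: b :: rcons q1 w).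
  rewrite (negPf (acyc _ _ _)) //; last by rewrite /= size_rcons.
  move: uq; rewrite -cat_rcons -[_ && _]/(uniq ((z :: b :: rcons q1 w) ++ q2)) cat_uniq.
  by case/andP.
move: pq => /andP[gzb]; rewrite -cat_rcons cat_path => /andP[pq _].
by rewrite /= gzb rcons_path pq last_rcons gsym gzw.
Qed.

(** Among the paths through [u] one of maximal size is taken; a neighbour of an end that is off the
    path would prolong it there. *)
Lemma longest_path_through u : exists z q,
  [/\ uniq (z :: q), path g z q, u \in z :: q,
      forall w, g z w -> w \in z :: q & forall w, g (last z q) w -> w \in z :: q].
Proof.
pose P n := [exists t : n.-tuple T, exists z, [&& uniq (z :: t), path g z t & u \in z :: t]].
have Pn z q : uniq (z :: q) -> path g z q -> u \in z :: q -> P (size q).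
  move=> uq pq uin; apply/existsP; exists (in_tuple q); apply/existsP; exists z.
  by rewrite [tval _]/(tval (in_tuple q)) /= in uq pq uin *; apply/and3P; split.
have P0 : exists n, P n by exists 0; apply: (Pn u [::]) => //=; rewrite mem_head.
have Pmax n : P n -> n <= #|T|.
  case/existsP=> t /existsP[z /and3P[/= /andP[_ ut] _ _]].
  by rewrite -(size_tuple t) -(card_uniqP ut) max_card.
have [k /existsP[t /existsP[z /and3P[uq pq uin]]] kmax] := ex_maxnP P0 Pmax.
have sz : size (tval t) = k by rewrite size_tuple.
move: (tval t) sz uq pq uin => q sz uq pq uin; exists z, q; split=> // w gw.
  apply/negPn/negP => nw; suff: P k.+1 by move/kmax; rewrite ltnn.
  rewrite -sz; apply: (Pn w (z :: q)); first by rewrite cons_uniq nw.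
    by rewrite /= gsym gw.
  by rewrite inE uin orbT.
apply/negPn/negP => nw; suff: P k.+1 by move/kmax; rewrite ltnn.
rewrite -sz -(size_rcons q w); apply: (Pn z).
- by rewrite -rcons_cons rcons_uniq nw.
- by rewrite rcons_path pq.
- by rewrite -rcons_cons mem_rcons inE uin orbT.
Qed.

End LongestPath.

Lemma graph_cycle_coverP (T : finType) (p : seq T) x :
  reflect (x \in cover [set [set x; next p x] | x in p]) (x \in p).
Proof.
apply: (iffP idP) => [xp|/bigcupP[A /imsetP[y yp ->]]].
  by apply/bigcupP; exists [set x; next p x]; [apply/imsetP; exists x|rewrite set21].
by rewrite !inE => /orP[]/eqP-> //; rewrite mem_next.
Qed.

Section UniqueCycle.
Variables (T : finType) (e f : rel T) (C : {set {set T}}) (H : {set T}).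
Hypotheses (e_sym : symmetric e) (eirr : irreflexive e).
Hypotheses (cycC : is_graph_cycle e C)
  (uniqC : forall C', is_graph_cycle e C' -> C' = C).
Hypotheses (fe : subrel f e) (fsym : symmetric f).
Hypothesis deg2 : forall u, u \in H ->
  exists x y, [/\ x != y, x \in H, y \in H, f u x & f u y].

(* Deleting an edge [st] of [C] leaves a forest, in which a longest path through
   [u] can only end at [s] and [t]; closing it with [st] gives [C] back. *)
Lemma unique_cycle_cover u : u \in H -> u \in cover C /\ cover C \subset H.
Proof.
move=> uH; have [p0 [up0 sp0 cp0 defC]] := cycC.
have [s [t [est neqst stC]]] : exists s t, [/\ e s t, s != t & [set s; t] \in C].
  case: p0 up0 sp0 cp0 defC => [//|s p0] up0 sp0 cp0 defC.
  have est := next_cycle cp0 (mem_head s p0).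
  exists s, (next (s :: p0) s); split=> //; first by apply: contraTneq est => <-; rewrite eirr.
  by rewrite defC; apply/imsetP; exists s; rewrite ?mem_head.
pose g x y := [&& f x y, x \in H, y \in H & [set x; y] != [set s; t]].
have gsym : symmetric g by move=> x y; rewrite /g fsym setUC; do 2!case: (_ \in H).
have girr : irreflexive g.
  by move=> x; rewrite /g; apply/negP => /andP[/fe]; rewrite eirr.
have ge : subrel g e by move=> x y /andP[/fe].
have acyc p : uniq p -> 3 <= size p -> ~~ cycle g p.
  move=> up sp; apply/negP => cp; have cpe := sub_cycle ge cp.
  have := stC; rewrite -(uniqC (C' := [set [set x; next p x] | x in p])); last by exists p.
  case/imsetP=> x xp eqst; have := next_cycle cp xp.
  by rewrite /g -eqst eqxx !andbF.
(* Away from [s] and [t] no edge was deleted, so both neighbours given by [deg2] survive in [g]. *)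
have end_st z : z \in H -> (forall w w', g z w -> g z w' -> w = w') -> z \in [set s; t].
  move=> zH unq; apply/negPn/negP => nz.
  have [x [y [neq xH yH fx fy]]] := deg2 zH.
  have gz w : w \in H -> f z w -> g z w.
    by move=> wH fw; rewrite /g fw zH wH; apply: contraNneq nz => <-; rewrite set21.
  by move/eqP: neq; apply; apply: unq; apply: gz.
have [z [q [uq pq uin nz nl]]] := longest_path_through gsym u.
have inH v : v \in z :: q -> v \in H.
  case: q uq pq uin {nz nl} => [|b q] uq pq.
    by rewrite !inE => /eqP <- /eqP ->.
  move=> _; rewrite inE => /orP[/eqP->|]; first by move: pq => /= /andP[/and4P[]].
  elim: (b :: q) (z) pq => [//|c r IH] a /= /andP[/and4P[_ _ cH _] pr].
  by rewrite inE => /orP[/eqP-> //|]; apply: IH pr.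
have zst := end_st z (inH z (mem_head _ _)) (front_neighbor_unique gsym girr acyc uq pq nz).
have [l defl] : exists l, l = last z q by exists (last z q).
rewrite -defl in nl.
have lin : l \in z :: q by rewrite defl mem_last.
have lst : l \in [set s; t].
  apply: end_st; first exact: inH.
  have defr : rev (z :: q) = l :: rev (belast z q).
    by rewrite lastI rev_rcons defl.
  apply: (front_neighbor_unique gsym girr acyc (q := rev (belast z q))).
  - by rewrite -defr rev_uniq.
  - by rewrite defl rev_path (eq_path (e' := g)) // => x y; rewrite gsym.
  - by move=> w /nl; rewrite -defr mem_rev.
(* If the path were the single vertex [u], both edges that [deg2] gives at [u] would be the one
   deleted edge. *)
have zl : z != l.
  apply/eqP => zl; case: q defl uq uin nz {pq nl inH lin} => [|b q] defl uq uin nz; last first.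
    by move: uq; rewrite cons_uniq zl defl /= mem_last.
  move: uin; rewrite inE => /eqP uz.
  have [x [y [neq xH yH fx fy]]] := deg2 uH; rewrite -uz in nz.
  have no w : w \in H -> f u w -> [set u; w] = [set s; t].
    move=> wH fw; apply/eqP/negPn/negP => nst.
    have guw : g u w by rewrite /g fw uH wH.
    by have := nz _ guw; rewrite inE => /eqP wu; rewrite wu girr in guw.
  have nxu v : f u v -> v != u by move=> fv; apply: contraTneq (fe fv) => ->; rewrite eirr.
  have : x \in [set u; y] by rewrite (no y) // -(no x) // set22.
  by rewrite !inE (negPf (nxu x fx)) (negPf neq).
have ezl : e l z.
  move: zst lst zl; rewrite !inE => /orP[]/eqP-> /orP[]/eqP->; rewrite ?eqxx // => _.
  by rewrite e_sym.
have setzl : [set z; l] = [set s; t].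
  apply/setP=> x; move: zst lst zl; rewrite !inE => /orP[]/eqP-> /orP[]/eqP->; rewrite ?eqxx // => _.
  by rewrite orbC.
have defC' : C = [set [set x; next (z :: q) x] | x in z :: q].
  apply/esym/uniqC; exists (z :: q); split=> //; last first.
    by rewrite /= rcons_path (sub_path ge pq) -defl.
  (* A path with two vertices is excluded, since its edge would be [st], which [g] lacks. *)
  case: q pq defl zl {uq uin nz nl inH lin} => [|b [|c q]] //=.
    by move=> _ ->; rewrite eqxx.
  by rewrite /g => /andP[/and4P[_ _ _ nst] _] defl; rewrite -setzl defl eqxx in nst.
split; first by rewrite defC'; apply/graph_cycle_coverP.
by apply/subsetP=> v; rewrite defC' => /graph_cycle_coverP/inH.
Qed.

End UniqueCycle.


(** * Internal and external numbers, and overspill *)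

(* A line is a natural number [l]; positions [x < l] lie on its side [true], the others
   on its side [false].  [closer s x y]: on side [s] of a line, [y] is nearer to it than [x]. *)
Definition side (s : bool) (x l : nat) : bool := if s then x < l else l <= x.
Definition closer (s : bool) (x y : nat) : bool := if s then x < y else y < x.

Record ultrafilter (T : Type) := Ultrafilter {
  ultra_sets :> classical_sets.set_system T;
  ultra_sets_ultra : UltraFilter ultra_sets
}.
#[global] Existing Instance ultra_sets_ultra.

Notation "\ae_ U w , P" := (ultra_sets U (fun w => P))
  (at level 200, U at level 0, w name, right associativity,
   format "\ae_ U  w ,  P") : type_scope.

(* [K] indexes a sequence of permutations and [U] lives on a set fibred over [K] by [kap]; a
   function on [K] is an internal number, a function on [Omega] a possibly external one. *)
Section Internal.
Variables (K Omega : Type) (kap : Omega -> K) (U : ultrafilter Omega).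

Local Notation num := (K -> nat).

Definition on s (x : num) (l : Omega -> nat) := \ae_ U w, side s (x (kap w)) (l w).
Definition cls s (x y : num) := \ae_ U w, closer s (x (kap w)) (y (kap w)).
Definition external (l : Omega -> nat) := forall a : num, \ae_ U w, l w != a (kap w).

Lemma ae_or (P : Omega -> Prop) :
  (\ae_ U w, P w) \/ (\ae_ U w, ~ P w).
Proof. exact: (in_ultra_setVsetC P (ultra_sets_ultra U)). Qed.

Lemma ae_and (P Q : Omega -> Prop) :
  (\ae_ U w, P w) -> (\ae_ U w, Q w) -> \ae_ U w, P w /\ Q w.
Proof. by move=> HP HQ; apply: filterS2 HP HQ. Qed.

Lemma ae_forall (I : finType) (P : I -> Omega -> Prop) :
  (forall i, \ae_ U w, P i w) -> \ae_ U w, forall i, P i w.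
Proof. exact: (@filter_forall Omega I P U). Qed.

Lemma ae_ex (P : Omega -> Prop) : (\ae_ U w, P w) -> exists w, P w.
Proof. by case/filter_ex => w; exists w. Qed.

Lemma ae_False : (\ae_ U w, False) -> False.
Proof. by case/ae_ex. Qed.

Lemma on_or s x l : on s x l \/ on (~~ s) x l.
Proof.
have [?|H] := ae_or (fun w => side s (x (kap w)) (l w)); [by left|right].
by apply: filterS H => w /negP; rewrite /side; case: s => /=; lia.
Qed.

Lemma on_neg s x l : on s x l -> on (~~ s) x l -> False.
Proof.
move=> H1 H2; apply: ae_False; apply: filterS2 H1 H2 => w.
by rewrite /side; case: s => /=; lia.
Qed.

Lemma cls_on s x y l : cls s x y -> on s y l -> on s x l.
Proof. by move=> H1 H2; apply: filterS2 H1 H2 => w; rewrite /closer /side; case: s => /=; lia. Qed.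

Lemma cls_on_neg s x y l : cls s x y -> on (~~ s) x l -> on (~~ s) y l.
Proof. by move=> H1 H2; apply: filterS2 H1 H2 => w; rewrite /closer /side; case: s => /=; lia. Qed.

Lemma on_cls s x y l : on s x l -> on (~~ s) y l -> cls s x y.
Proof. by move=> H1 H2; apply: filterS2 H1 H2 => w; rewrite /closer /side; case: s => /=; lia. Qed.

Lemma on_clsN s x y l : on s x l -> on (~~ s) y l -> cls (~~ s) y x.
Proof. by move=> H1 H2; apply: filterS2 H1 H2 => w; rewrite /closer /side; case: s => /=; lia. Qed.

Lemma clsN s x y : cls s x y -> cls (~~ s) y x.
Proof. by apply: filterS => w; rewrite /closer; case: s. Qed.

Lemma cls_trans s x y z : cls s x y -> cls s y z -> cls s x z.
Proof. by move=> H1 H2; apply: filterS2 H1 H2 => w; rewrite /closer; case: s => /=; lia. Qed.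

Lemma cls_asym s x y : cls s x y -> cls (~~ s) x y -> False.
Proof.
move=> H1 H2; apply: ae_False; apply: filterS2 H1 H2 => w.
by rewrite /closer; case: s => /=; lia.
Qed.

Lemma closest2 s (x y : num) l : on s x l -> on s y l ->
  exists z, on s z l /\ forall v, cls s z v -> cls s x v /\ cls s y v.
Proof.
move=> H1 H2; exists (fun k => if s then maxn (x k) (y k) else minn (x k) (y k)); split.
  by apply: filterS2 H1 H2 => w; rewrite /side; case: s => /=; lia.
by move=> v H; split; apply: filterS H => w; rewrite /closer; case: (s) => /=; lia.
Qed.

(** A counterexample chosen for every [k] that has one is itself an internal object, to which the
    hypothesis applies. *)
Lemma internalize (T : Type) (t0 : T) (A B : K -> T -> Prop) :
  (forall x : K -> T, (\ae_ U w, A (kap w) (x (kap w))) ->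
     \ae_ U w, B (kap w) (x (kap w))) ->
  \ae_ U w, forall x, A (kap w) x -> B (kap w) x.
Proof.
move=> H; have /choice[c cP] k : exists t, (exists x, A k x /\ ~ B k x) -> A k t /\ ~ B k t.
  have [[x xP]|n] := pselect (exists x, A k x /\ ~ B k x); first by exists x.
  by exists t0 => /n.
case: (ae_or (fun w => forall x, A (kap w) x -> B (kap w) x)) => // Hn.
have cA : \ae_ U w, A (kap w) (c (kap w)) /\ ~ B (kap w) (c (kap w)).
  apply: filterS Hn => w nw; apply: cP; apply: contrapT => ne; apply: nw => x Ax.
  by apply: contrapT => nB; apply: ne; exists x.
have cB : \ae_ U w, B (kap w) (c (kap w)).
  by apply: H; apply: filterS cA => w [].
by exfalso; apply: ae_False; apply: filterS2 cA cB => w [].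
Qed.

(** Whether a witness exists depends on [kap w] only, so the witness can be chosen on [K]. *)
Lemma choose_internal (T : Type) (t0 : T) (A : K -> T -> Prop) :
  (\ae_ U w, exists x, A (kap w) x) ->
  exists x : K -> T, \ae_ U w, A (kap w) (x (kap w)).
Proof.
move=> H; have /choice[c cP] k : exists t, (exists x, A k x) -> A k t.
  have [[x xP]|n] := pselect (exists x, A k x); first by exists x.
  by exists t0 => /n.
by exists c; apply: filterS H => w; apply: cP.
Qed.

(** The exact meaning of moving a line slightly: [P] holds throughout an interval with internal ends
    that contains the line. *)
Definition near_line (l : Omega -> nat) (P : K -> nat -> Prop) := exists lo hi : num,
  (\ae_ U w, lo (kap w) <= l w <= hi (kap w)) /\
  (\ae_ U w, forall x, lo (kap w) <= x <= hi (kap w) -> P (kap w) x).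

Definition bounded_line (l : Omega -> nat) := exists B : num, \ae_ U w, l w <= B (kap w).

(** Overspill. The thresholds up to which [Q] holds on side [s] form an internal set, so they have
    an extremal element. If this stopped short of [l], the next position would still be on side [s]
    of [l], would satisfy [Q], and the threshold could be moved by one. *)
Lemma spill s l (Q : K -> nat -> Prop) : bounded_line l ->
  (forall x, on s x l -> \ae_ U w, Q (kap w) (x (kap w))) ->
  near_line l (fun k a => forall x, side s x a -> Q k x).
Proof.
move=> [B lB] HQ.
pose good k a := `[< forall x, side s x a -> Q k x >].
case: s HQ @good => HQ good.
  have ex0 k : exists a, (a <= B k) && good k a.
    by exists 0; apply/andP; split=> //; apply/asboolP => x; rewrite /side ltn0.
  have bnd k a : (a <= B k) && good k a -> a <= B k by case/andP.
  exists (fun=> 0), (fun k => ex_maxn (ex0 k) (bnd k)).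
  have gd k : good k (ex_maxn (ex0 k) (bnd k)) by case: ex_maxnP => i /andP[].
  split; last first.
    apply: nearW => w x /andP[_ le] y; rewrite /side => yx.
    by move/asboolP: (gd (kap w)); apply; rewrite /side (leq_trans yx).
  have [//|Hn] := ae_or (fun w => 0 <= l w <= ex_maxn (ex0 (kap w)) (bnd (kap w))).
  have lt : \ae_ U w, ex_maxn (ex0 (kap w)) (bnd (kap w)) < l w.
    by apply: filterS Hn => w; rewrite /=; lia.
  have : \ae_ U w, Q (kap w) (ex_maxn (ex0 (kap w)) (bnd (kap w))).
    apply: (HQ (fun k => ex_maxn (ex0 k) (bnd k))).
    by apply: filterS lt => w; rewrite /side => ->.
  move=> HQ'; exfalso; apply: ae_False; apply: filterS3 lt lB HQ' => w.
  case: ex_maxnP => i /andP[iB /asboolP gi] imax ltl lb q.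
  suff : i.+1 <= i by rewrite ltnn.
  apply: imax; rewrite (leq_trans ltl lb); apply/asboolP => x.
  rewrite /side ltnS leq_eqVlt => /orP[/eqP-> //|xi].
  by apply: gi; rewrite /side xi.
(* On this side a threshold need not exist for every [k]; but failures of [Q] above [B] would lie on
   side [false] of [l]. *)
have exl : \ae_ U w, exists a, good (kap w) a.
  have [//|Hn] := ae_or (fun w => exists a, good (kap w) a).
  have [x xP] : exists x : num, \ae_ U w, B (kap w) <= x (kap w) /\ ~ Q (kap w) (x (kap w)).
    apply: (choose_internal (A := fun k x => B k <= x /\ ~ Q k x) 0).
    apply: filterS Hn => w nw; apply: contrapT => ne.
    apply: nw; exists (B (kap w)); apply/asboolP => x; rewrite /side => xB; apply: contrapT => nQ.
    by apply: ne; exists x; split=> //; lia.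
  have Qx : \ae_ U w, Q (kap w) (x (kap w)).
    by apply: HQ; apply: filterS2 xP lB => w [Bx _] lw; rewrite /side /=; lia.
  by exfalso; apply: ae_False; apply: filterS2 xP Qx => w [].
have [lo loP] : exists lo : num, \ae_ U w,
    good (kap w) (lo (kap w)) /\ forall a, good (kap w) a -> lo (kap w) <= a.
  apply: (choose_internal (A := fun k x => good k x /\ forall a, good k a -> x <= a) 0).
  apply: filterS exl => w ex.
  by case: (ex_minnP ex) => i gi im; exists i.
have le : \ae_ U w, lo (kap w) <= l w.
  have [//|Hn] := ae_or (fun w => lo (kap w) <= l w).
  have : \ae_ U w, Q (kap w) (lo (kap w)).-1.
    by apply: (HQ (fun k => (lo k).-1)); apply: filterS Hn => w; rewrite /side /=; lia.
  move=> HQ'; exfalso; apply: ae_False; apply: filterS3 Hn loP HQ' => w nle [g gmin] q.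
  suff : lo (kap w) <= (lo (kap w)).-1 by lia.
  apply: gmin; apply/asboolP => x; rewrite /side => xl.
  have [->//|ne] := eqVneq x (lo (kap w)).-1.
  by move/asboolP: g; apply; rewrite /side /=; lia.
exists lo, B; split; first by apply: filterS2 le lB => w -> ->.
apply: filterS loP => w [/asboolP g _] a /andP[la _] x; rewrite /side => xa.
by apply: g; rewrite /side /=; lia.
Qed.

(** An external line is never equal to the ends of the interval from [spill], so the interval
    reaches strictly past it. *)
Lemma spill_over s l (Q : K -> nat -> Prop) : bounded_line l -> external l ->
  (forall x, on s x l -> \ae_ U w, Q (kap w) (x (kap w))) ->
  exists x, on (~~ s) x l /\ \ae_ U w, Q (kap w) (x (kap w)).
Proof.
move=> bl el HQ; have [lo [hi [lh HP]]] := spill bl HQ.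
have e1 := el lo; have e2 := el hi.
case: s HQ HP => HQ HP.
  exists (fun k => (hi k).-1); split.
    by apply: filterS2 lh e2 => w; rewrite /side /=; lia.
  by apply: filterS3 lh e2 HP => w lhw ew Hw; apply: (Hw (hi (kap w))); rewrite ?/side /=; lia.
exists lo; split.
  by apply: filterS2 lh e1 => w; rewrite /side /=; lia.
by apply: filterS3 lh e1 HP => w lhw ew Hw; apply: (Hw (lo (kap w))); rewrite ?/side /=; lia.
Qed.

End Internal.


(** * Points in the four quadrants at the crossing of two lines *)

Section Quadrants.
Variables (K Omega : Type) (kap : Omega -> K) (U : ultrafilter Omega).
Variables (P : K -> nat -> nat -> Prop) (lx ly : Omega -> nat).

Local Notation num := (K -> nat).
Local Notation on := (on kap U).
Local Notation cls := (cls kap U).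

Definition point (x y : num) := \ae_ U w, P (kap w) (x (kap w)) (y (kap w)).

Definition beyond s t (x0 y0 x y : num) :=
  [/\ point x y, cls s x0 x /\ on s x lx & cls t y0 y /\ on t y ly].

(** The points of this quadrant come arbitrarily near to both lines at once; this is the obstruction
    to moving the lines independently. *)
Definition cofinal s t := forall x0 y0, on s x0 lx -> on t y0 ly ->
  exists x y, beyond s t x0 y0 x y.

Definition diagonal s t x0 y0 := forall x y x' y',
  beyond s t x0 y0 x y -> beyond s t x0 y0 x' y' -> cls s x x' -> cls t y y'.

Definition vacant s t x0 y0 := forall x y, ~ beyond s t x0 y0 x y.

Lemma beyondI s t x0 y0 x y : point x y -> cls s x0 x -> on s x lx -> cls t y0 y ->
  on t y ly -> beyond s t x0 y0 x y.
Proof. by []. Qed.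

Lemma not_cofinal s t : ~ cofinal s t ->
  exists x0 y0, [/\ on s x0 lx, on t y0 ly & vacant s t x0 y0].
Proof.
move=> nc; apply: contrapT => ne; apply: nc => x0 y0 sx0 ty0.
apply: contrapT => nxy; apply: ne; exists x0, y0; split=> // x y b.
by apply: nxy; exists x, y.
Qed.

End Quadrants.

Lemma beyond_tr K Omega (kap : Omega -> K) U P lx ly s t x0 y0 x y :
  beyond kap U (fun k x y => P k y x) ly lx t s y0 x0 y x ->
  beyond kap U P lx ly s t x0 y0 x y.
Proof. by case. Qed.

Lemma cofinal_tr K Omega (kap : Omega -> K) U P lx ly s t :
  cofinal kap U P lx ly s t -> cofinal kap U (fun k x y => P k y x) ly lx t s.
Proof.
by move=> c y0 x0 ty sx; have [x [y b]] := c x0 y0 sx ty; exists y, x; apply/beyond_tr.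
Qed.

Section Corner.
Variables (K Omega : Type) (kap : Omega -> K) (U : ultrafilter Omega).
Variables (P : K -> nat -> nat -> Prop) (lx ly : Omega -> nat).

Local Notation num := (K -> nat).
Local Notation on := (on kap U).
Local Notation cls := (cls kap U).
Local Notation point := (point kap U P).
Local Notation beyond := (beyond kap U P lx ly).
Local Notation cofinal := (cofinal kap U P lx ly).
Local Notation diagonal := (diagonal kap U P lx ly).
Local Notation vacant := (vacant kap U P lx ly).

Hypotheses (bx : bounded_line kap U lx) (ex : external kap U lx).

Definition diagonals := forall s t, cofinal s t ->
  exists x0 y0, [/\ on s x0 lx, on t y0 ly & diagonal s t x0 y0].

(* If both were cofinal, then near the line [lx] every point on its side [s] would be
   extremal in height among the later ones; by overspill this persists beyond [lx], which
   forbids points just beyond [lx], so that the last points on side [s] define [lx]. *)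
Lemma cofinal_adjacent s t : diagonals -> cofinal s t -> cofinal s (~~ t) -> False.
Proof.
move=> HQ c1 c2.
have [x1 [y1 [sx1 ty1 d1]]] := HQ _ _ c1; have [x2 [y2 [sx2 ty2 d2]]] := HQ _ _ c2.
have [px [py pb]] := c1 _ _ sx1 ty1; have [qx [qy qb]] := c2 _ _ sx2 ty2.
have [_ [clpx onpx] [clpy onpy]] := pb; have [_ [clqx onqx] [clqy onqy]] := qb.
have [xa [onxa xaP]] := closest2 onpx onqx.
(* A band of heights that contains [ly], between a point of either chain. *)
pose inY k y := closer t (py k) y /\ closer (~~ t) (qy k) y.
pose pt k (r : nat * nat) := P k r.1 r.2 /\ inY k r.2.
pose ZA k a (r : (nat * nat) * (nat * nat) * (nat * nat)) :=
  [/\ pt k r.1.1, pt k r.1.2, pt k r.2 &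
   [/\ closer s (xa k) r.1.1.1, closer s r.1.1.1 r.1.2.1, closer s r.1.1.1 r.2.1,
     ~~ closer s a r.1.2.1 & ~~ closer s a r.2.1]].
pose ZB (r : (nat * nat) * (nat * nat) * (nat * nat)) :=
  ~ (closer t r.1.1.2 r.1.2.2 /\ closer (~~ t) r.1.1.2 r.2.2).
(* [Z k a]: no point of the band past [xa] has both a higher and a lower point among the later
   points of the band up to [a]. *)
pose Z k a := forall r, ZA k a r -> ZB r.
(* On side [t] of [ly], the later points of the same chain are nearer to [ly] and those of the other
   chain are across it, so all lie in one direction; likewise on the other side. *)
have Zs a : on s a lx -> \ae_ U w, Z (kap w) (a (kap w)).
  move=> ona; apply: (internalize (A := fun k r => ZA k (a k) r) (B := fun=> ZB) (0, 0, (0, 0), (0, 0))).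
  move=> r rP; have [//|rN] := ae_or U (fun w => ZB (r (kap w))).
  pose x k := (r k).1.1.1; pose y k := (r k).1.1.2.
  pose x' k := (r k).1.2.1; pose y' k := (r k).1.2.2.
  pose x'' k := (r k).2.1; pose y'' k := (r k).2.2.
  have xx' : cls s x x' by apply: filterS rP => w [_ _ _ []].
  have xx'' : cls s x x'' by apply: filterS rP => w [_ _ _ []].
  have xax : cls s xa x by apply: filterS rP => w [_ _ _ []].
  have yy' : cls t y y' by apply: filterS rN => w /contrapT[].
  have yy'' : cls (~~ t) y y'' by apply: filterS rN => w /contrapT[].
  have onx' : on s x' lx.
    apply: filterS2 rP ona => w [_ _ _ [_ _ _ + _]].
    by rewrite /closer /side /x'; case: (s) => /=; lia.
  have onx'' : on s x'' lx.
    apply: filterS2 rP ona => w [_ _ _ [_ _ _ _ +]].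
    by rewrite /closer /side /x''; case: (s) => /=; lia.
  have onx : on s x lx := cls_on xx' onx'.
  have pxy : point x y by apply: filterS rP => w [[]].
  have pxy' : point x' y' by apply: filterS rP => w [_ []].
  have pxy'' : point x'' y'' by apply: filterS rP => w [_ _ []].
  have [pya pyb] : cls t py y /\ cls (~~ t) qy y.
    by split; apply: filterS rP => w [[_ []]].
  have [pya' pyb'] : cls t py y' /\ cls (~~ t) qy y'.
    by split; apply: filterS rP => w [_ [_ []]].
  have [pya'' pyb''] : cls t py y'' /\ cls (~~ t) qy y''.
    by split; apply: filterS rP => w [_ _ [_ []]].
  have [[xp xq] [xp' xq'] [xp'' xq'']] :
    [/\ cls s px x /\ cls s qx x, cls s px x' /\ cls s qx x' & cls s px x'' /\ cls s qx x''].
    by split; apply: xaP => //; exact: cls_trans xax _.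
  exfalso; have [ony|ony] := on_or kap U t y ly.
    have [ony''|ony''] := on_or kap U t y'' ly; last exact: cls_asym (on_cls ony ony'') yy''.
    apply: (cls_asym _ yy''); apply: (d1 x y x'' y'') => //.
      exact: beyondI pxy (cls_trans clpx xp) onx (cls_trans clpy pya) ony.
    exact: beyondI pxy'' (cls_trans clpx xp'') onx'' (cls_trans clpy pya'') ony''.
  have [ony'|ony'] := on_or kap U t y' ly; first by apply: (cls_asym yy'); exact: on_clsN ony' ony.
  apply: (cls_asym yy'); apply: (d2 x y x' y') => //.
    exact: beyondI pxy (cls_trans clqx xq) onx (cls_trans clqy pyb) ony.
  exact: beyondI pxy' (cls_trans clqx xq') onx' (cls_trans clqy pyb') ony'.
have [a [ona Za]] := spill_over bx ex Zs.
(* A second overspill puts a point [r] of the band beyond [lx], but not past [a], where [Z] still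
   applies. *)
pose Z2 k x := exists r : nat * nat, [/\ pt k r, closer s x r.1 & ~~ closer s (a k) r.1].
have Z2s x : on s x lx -> \ae_ U w, Z2 (kap w) (x (kap w)).
  move=> onx; have [x' [y' [pxy [xx' onx'] [pyy ony']]]] := c1 _ _ onx onpy.
  apply: filterS3 pxy xx' (ae_and pyy (ae_and (on_clsN ony' onqy) (on_cls onx' ona))) => w /= p1 c [cy [cq ca]].
  by exists (x' (kap w), y' (kap w)); split=> //=; move: ca; rewrite /closer; case: (s); lia.
have [b [onb Zb]] := spill_over bx ex Z2s.
have [r rP] := choose_internal (A := fun k (r : nat * nat) =>
  [/\ pt k r, closer s (b k) r.1 & ~~ closer s (a k) r.1]) (0, 0) Zb.
pose x' k := (r k).1; pose y' k := (r k).2.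
have onx' : on (~~ s) x' lx.
  by apply: cls_on_neg onb; apply: filterS rP => w [].
have contra u r1x r1y r2x r2y : on s r1x lx -> cls s xa r1x -> point r1x r1y -> point r2x r2y ->
    cls s r1x r2x -> on s r2x lx -> cls t py r1y -> cls (~~ t) qy r1y -> cls t py r2y ->
    cls (~~ t) qy r2y -> cls u r1y r2y -> cls (~~ u) r1y y' -> False.
  move=> on1 xa1 p1 p2 x12 on2 h1 h1' h2 h2' h12 h1y'.
  have A1 := ae_and (ae_and Za rP) (ae_and (ae_and xa1 x12) (ae_and (on_cls on1 onx') (on_cls on2 ona))).
  have A2 := ae_and (ae_and p1 p2) (ae_and (ae_and h1 h1') (ae_and h2 h2')).
  apply: (@ae_False _ U);  apply: filterS3 A1 A2 (ae_and h12 h1y') => w /= [[zw [ptr _ ra]] [[? ?] [? c2a]]] [[? ?] [[? ?] [? ?]]] [c12 c1'].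
  have ? : ~~ closer s (a (kap w)) (r2x (kap w)) by move: c2a; rewrite /closer; case: (s); lia.
  have pt1 : pt (kap w) (r1x (kap w), r1y (kap w)) by [].
  have pt2 : pt (kap w) (r2x (kap w), r2y (kap w)) by [].
  have [ut|ut] := eqVneq u t.
    apply: (zw ((r1x (kap w), r1y (kap w)), (r2x (kap w), r2y (kap w)), r (kap w))).
      by split=> //; split.
    by rewrite -ut.
  have {}ut : u = ~~ t by move: ut; case: (u); case: (t).
  apply: (zw ((r1x (kap w), r1y (kap w)), r (kap w), (r2x (kap w), r2y (kap w)))).
    by split=> //; split.
  by move: c12 c1'; rewrite ut negbK; split.
have [ry1 ry2] : cls t py y' /\ cls (~~ t) qy y'.
  by split; apply: filterS rP => w [[_ []]].
(* A chain point [r1] with height between [r] and [ly] has [r] in one vertical direction and a later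
   point of the other chain in the other, against [Z]. *)
have [ony'|ony'] := on_or kap U t y' ly.
  have [r1x [r1y [p1 [hx1 on1] [yy1 ony1]]]] := c1 _ _ onxa ony'.
  have [r2x [r2y [p2 [hx21 on2] [yy2 ony2]]]] := c2 _ _ on1 onqy.
  apply: (contra t r1x r1y r2x r2y) => //.
  - exact: cls_trans ry1 _.
  - exact: on_clsN ony1 onqy.
  - exact: on_cls onpy ony2.
  - exact: on_cls ony1 ony2.
  - exact: clsN.
have [r1x [r1y [p1 [hx1 on1] [yy1 ony1]]]] := c2 _ _ onxa ony'.
have [r2x [r2y [p2 [hx21 on2] [yy2 ony2]]]] := c1 _ _ on1 onpy.
apply: (contra (~~ t) r1x r1y r2x r2y) => //.
- exact: on_cls onpy ony1.
- exact: cls_trans ry2 _.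
- exact: on_clsN ony2 onqy.
- exact: on_clsN ony2 ony1.
- by have := clsN yy1.
Qed.

(** Otherwise both quadrants across [lx] are vacant near the crossing. But a band around [ly] has
    points arbitrarily near [lx] on side [s], and overspill yields one of the band beyond [lx],
    inside a vacant quadrant. *)
Lemma cofinal_opposite s t : cofinal s t -> ~ cofinal (~~ s) t -> cofinal (~~ s) (~~ t).
Proof.
move=> c n1; apply: contrapT => n2.
have [x2 [y2 [sx2 ty2 v2]]] := not_cofinal n1; have [x3 [y3 [sx3 ty3 v3]]] := not_cofinal n2.
have [xb [onxb xbP]] := closest2 sx2 sx3.
pose Q k (r : nat * nat) := [/\ P k r.1 r.2, closer (~~ s) (xb k) r.1, closer t (y2 k) r.2
  & closer (~~ t) (y3 k) r.2].
pose Z k x := exists r, Q k r /\ closer s x r.1.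
have Zs x : on s x lx -> \ae_ U w, Z (kap w) (x (kap w)).
  move=> onx; have [x' [y' [pxy [xx' onx'] [yy ony']]]] := c _ _ onx ty2.
  apply: filterS3 pxy xx' (ae_and yy (ae_and (on_clsN onx' onxb) (on_clsN ony' ty3))) => w /= p1 cx [cy [cxb cy3]].
  by exists (x' (kap w), y' (kap w)).
have [b [onb Zb]] := spill_over bx ex Zs.
have [r rP] := choose_internal (A := fun k (r : nat * nat) => Q k r /\ closer s (b k) r.1) (0, 0) Zb.
pose x' k := (r k).1; pose y' k := (r k).2.
have onx' : on (~~ s) x' lx.
  by apply: cls_on_neg onb; apply: filterS rP => w [].
have [xb2 xb3] : cls (~~ s) x2 x' /\ cls (~~ s) x3 x'.
  by apply: xbP; apply: filterS rP => w [[]].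
have pxy : point x' y' by apply: filterS rP => w [[]].
have [ony|ony] := on_or kap U t y' ly.
  by apply: (v2 x' y'); apply: beyondI => //; apply: filterS rP => w [[]].
by apply: (v3 x' y'); apply: beyondI => //; apply: filterS rP => w [[]].
Qed.

End Corner.


(** As [f] swaps the sides, [x <= f x] holds on side [true] and fails on side [false]; overspill of
    this internal inequality past [l] is the contradiction. *)
Lemma twisted_not_external K Omega (kap : Omega -> K) (U : ultrafilter Omega) l (f : K -> nat -> nat) :
  bounded_line kap U l -> external kap U l ->
  (forall s a, on kap U s a l -> on kap U (~~ s) (fun k => f k (a k)) l) -> False.
Proof.
move=> bl el fP.
have [x [xl xf]] : exists x, on kap U (~~ true) x l /\ \ae_ U w, x (kap w) <= f (kap w) (x (kap w)).
  apply: (spill_over (Q := fun k x => x <= f k x) bl el) => x /[dup] /fP.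
  by apply: filterS2 => w; rewrite /side /=; lia.
apply: (@ae_False _ U); apply: filterS3 (fP _ _ xl) xl xf => w.
by rewrite /side /=; lia.
Qed.

(** * Boxes around the crossing of two external lines *)

Section Box.
Variables (K Omega : Type) (kap : Omega -> K) (U : ultrafilter Omega).
Variables (P : K -> nat -> nat -> Prop) (lx ly : Omega -> nat).

Local Notation num := (K -> nat).
Local Notation on := (on kap U).
Local Notation cls := (cls kap U).
Local Notation point := (point kap U P).
Local Notation beyond := (beyond kap U P lx ly).
Local Notation cofinal := (cofinal kap U P lx ly).
Local Notation diagonal := (diagonal kap U P lx ly).
Local Notation vacant := (vacant kap U P lx ly).

(* Around two external lines the points either avoid a whole box ([sg = None]) or form a
   chain through the crossing, increasing if [sg = Some true] and decreasing if [Some false]. *)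
Definition crossing_box (sg : option bool) (xs ys : bool -> num) :=
  [/\ forall s, on s (xs s) lx, forall t, on t (ys t) ly &
      forall s t, if sg == Some (s == t)
        then cofinal s t /\ diagonal s t (xs s) (ys t) else vacant s t (xs s) (ys t)].

Definition in_box (xs ys : bool -> num) k x y :=
  [/\ P k x y, xs true k < x < xs false k & ys true k < y < ys false k].

(** The tie between two lines: the vertical line [a] and the horizontal line [b] divide the chain in
    the box at the same place. *)
Definition on_curve sg xs ys k a b := forall x y, in_box xs ys k x y ->
  if sg is Some t then side true x a = side t y b else True.

Lemma beyond_in_box xs ys x y s t :
  (\ae_ U w, in_box xs ys (kap w) (x (kap w)) (y (kap w))) ->
  on s x lx -> on t y ly -> beyond s t (xs s) (ys t) x y.
Proof.
move=> H onx ony; split; first by apply: filterS H => w [].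
  split=> //; apply: filterS H => w [_ + _]; rewrite /closer.
  by case: (s) => /andP[].
split=> //; apply: filterS H => w [_ _]; rewrite /closer.
by case: (t) => /andP[].
Qed.

Lemma box_none xs ys : crossing_box None xs ys ->
  \ae_ U w, forall x y, ~ in_box xs ys (kap w) x y.
Proof.
case=> onx ony vac.
have : \ae_ U w, forall r : nat * nat, in_box xs ys (kap w) r.1 r.2 -> False.
  apply: (internalize (A := fun k (r : nat * nat) => in_box xs ys k r.1 r.2) (B := fun _ _ => False) (0, 0)).
  move=> r rP; pose x k := (r k).1; pose y k := (r k).2.
  have [s onsx] : exists s, on s x lx.
    by have [?|?] := on_or kap U true x lx; [exists true|exists false].
  have [t onty] : exists t, on t y ly.
    by have [?|?] := on_or kap U true y ly; [exists true|exists false].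
  exfalso; have v : vacant s t (xs s) (ys t) := vac s t; apply: (v x y).
  exact: (beyond_in_box (x := x) (y := y)).
by apply: filterS => w H x y; apply: (H (x, y)).
Qed.

(** Two points in one quadrant are ordered by [diagonal]; two points in opposite quadrants are
    separated by both lines. *)
Lemma box_monotone sg xs ys : crossing_box (Some sg) xs ys -> \ae_ U w, forall x y x' y',
  in_box xs ys (kap w) x y -> in_box xs ys (kap w) x' y' -> x < x' -> closer sg y y'.
Proof.
case=> onx ony dv.
have : \ae_ U w, forall r : (nat * nat) * (nat * nat),
    [/\ in_box xs ys (kap w) r.1.1 r.1.2, in_box xs ys (kap w) r.2.1 r.2.2 & r.1.1 < r.2.1] ->
    closer sg r.1.2 r.2.2.
  apply: (internalize (A := fun k (r : (nat * nat) * (nat * nat)) =>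
    [/\ in_box xs ys k r.1.1 r.1.2, in_box xs ys k r.2.1 r.2.2 & r.1.1 < r.2.1])
    (B := fun _ r => closer sg r.1.2 r.2.2) (0, 0, (0, 0))).
  move=> r rP; pose x k := (r k).1.1; pose y k := (r k).1.2.
  pose x' k := (r k).2.1; pose y' k := (r k).2.2.
  have side_of z w : (\ae_ U v, in_box xs ys (kap v) (z (kap v)) (w (kap v))) ->
      exists s, [/\ on s z lx, on (s == sg) w ly & beyond s (s == sg) (xs s) (ys (s == sg)) z w].
    move=> zw; have [s onz] : exists s, on s z lx.
      by have [?|?] := on_or kap U true z lx; [exists true|exists false].
    have [t onw] : exists t, on t w ly.
      by have [?|?] := on_or kap U true w ly; [exists true|exists false].
    have b := beyond_in_box zw onz onw; exists s; suff -> : (s == sg) = t by split.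
    have := dv s t; case: eqP => [[->] _|_ v]; first by case: (s); case: (t).
    by case: (v _ _ b).
  have [s [sx sy sb]] := side_of x y (filterS (fun w (h : [/\ _, _ & _]) => let: And3 h1 _ _ := h in h1) rP).
  have [s' [sx' sy' sb']] := side_of x' y' (filterS (fun w (h : [/\ _, _ & _]) => let: And3 _ h1 _ := h in h1) rP).
  have lt : cls true x x' by apply: filterS rP => w [].
  suff : cls sg y y' by [].
  have [ss|ss] := eqVneq s s'.
    have := dv s (s == sg); rewrite -ss in sb'; case: eqP => [_ [_ d]|ne]; last first.
      by exfalso; apply: ne; case: (s); case: (sg).
    case: (s) sb sb' d {sx sy sx' sy' ss dv} => sb sb' d.
      by have := d _ _ _ _ sb sb' lt; case: (sg).
    have := d _ _ _ _ sb' sb (clsN lt) => /clsN; by case: (sg).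
  move: ss sx sx' sy sy'; case: (s); case: (s') => // _ sx sx' sy sy'; last first.
    by exfalso; apply: cls_asym lt (on_clsN sx' sx).
  by move: sy sy'; case: (sg) => sy sy'; [exact: on_cls sy sy'|exact: on_cls sy sy'].
by apply: filterS => w H x y x' y' b b' lt; apply: (H ((x, y), (x', y'))).
Qed.

End Box.


Section Transposition.
Variables (K Omega : Type) (kap : Omega -> K) (U : ultrafilter Omega).
Variables (P : K -> nat -> nat -> Prop) (lx ly : Omega -> nat).
Hypotheses (Pfun : forall k x y y', P k x y -> P k x y' -> y = y').

Lemma diagonal_tr s t x0 y0 : diagonal kap U P lx ly s t x0 y0 ->
  diagonal kap U (fun k x y => P k y x) ly lx t s y0 x0.
Proof.
move=> d x y x' y' b b' lt.
have [//|nc] := ae_or U (fun w => closer s (y (kap w)) (y' (kap w))).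
have [eq|ne] := ae_or U (fun w => y (kap w) = y' (kap w)).
  case: b b' => p _ _ [p' _ _]; exfalso; apply: (@ae_False _ U).
  move: eq p p' => /(ae_and lt) H p p'; apply: filterS3 H p p' => w [c e].
  by rewrite /= e => h /(Pfun h) e'; move: c; rewrite /closer e' ltnn; case: (t).
have c' : cls kap U s y' y.
  apply: filterS2 nc ne => w; rewrite /closer; case: (s); lia.
have := d _ _ _ _ (beyond_tr b') (beyond_tr b) c' => /clsN lt'.
by exfalso; apply: cls_asym lt lt'.
Qed.

Lemma crossing_box_tr sg xs ys : crossing_box kap U P lx ly sg xs ys ->
  crossing_box kap U (fun k x y => P k y x) ly lx sg ys xs.
Proof.
case=> onx ony dv; split=> // t s; have := dv s t.
rewrite (_ : (s == t) = (t == s)); last by rewrite eq_sym.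
case: ifP => _; last by move=> v y x /beyond_tr; exact: (v x y).
by case=> c d; split; [exact: cofinal_tr|exact: diagonal_tr].
Qed.

End Transposition.

Section Crossing.
Variables (K Omega : Type) (kap : Omega -> K) (U : ultrafilter Omega).
Variables (P : K -> nat -> nat -> Prop) (lx ly : Omega -> nat).

Local Notation num := (K -> nat).
Local Notation on := (on kap U).
Local Notation cls := (cls kap U).
Local Notation point := (point kap U P).
Local Notation beyond := (beyond kap U P lx ly).
Local Notation cofinal := (cofinal kap U P lx ly).
Local Notation diagonal := (diagonal kap U P lx ly).
Local Notation vacant := (vacant kap U P lx ly).
Local Notation crossing_box := (crossing_box kap U P lx ly).
Local Notation in_box := (in_box P).

Hypotheses (Pfun : forall k x y y', P k x y -> P k x y' -> y = y').
Hypotheses (bx : bounded_line kap U lx) (ex : external kap U lx).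
Hypotheses (by_ : bounded_line kap U ly) (ey : external kap U ly).

(** Cofinal quadrants exclude their neighbours and force their opposites, so they are none or a
    diagonal pair. *)
Lemma cofinal_sign : diagonals kap U P lx ly ->
  exists sg, forall s t, cofinal s t <-> sg = Some (s == t).
Proof.
move=> HQ.
have HQt : diagonals kap U (fun k x y => P k y x) ly lx.
  by move=> t s /cofinal_tr /HQ[x0 [y0 [ox oy d]]]; exists y0, x0; split=> //; exact: (diagonal_tr Pfun).
have adj1 s t : cofinal s t -> cofinal s (~~ t) -> False := cofinal_adjacent bx ex HQ.
have adj2 s t : cofinal s t -> cofinal (~~ s) t -> False.
  by move=> /cofinal_tr c1 /cofinal_tr c2; exact: (cofinal_adjacent by_ ey HQt c1 c2).
have opp s t : cofinal s t -> cofinal (~~ s) (~~ t).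
  by move=> c; apply: (cofinal_opposite bx ex c) => c'; apply: adj2 c c'.
have all b s t : cofinal true b -> cofinal s t <-> Some b = Some (s == t).
  move=> c; have c' := opp _ _ c.
  have n1 := fun c1 => adj1 _ _ c c1; have n2 := fun c1 => adj2 _ _ c c1.
  have n3 := fun c1 => adj1 _ _ c' c1; have n4 := fun c1 => adj2 _ _ c' c1.
  split=> [cst|[]]; last by case: s; case: t; case: b c c' {n1 n2 n3 n4} => // ? ? _.
  by case: s t cst b c c' n1 n2 n3 n4 => [] [] cst [] //= c c' n1 n2 n3 n4; exfalso; auto.
have [c|n1] := pselect (cofinal true true); first by exists (Some true) => s t; exact: all.
have [c|n2] := pselect (cofinal true false); first by exists (Some false) => s t; exact: all.
exists None => s t; split=> // c; exfalso.
by case: s t c => [] [] c //; have := opp _ _ c.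
Qed.

Lemma beyond_trans s t x0 y0 x1 y1 x y : (forall v, cls s x1 v -> cls s x0 v) ->
  (forall v, cls t y1 v -> cls t y0 v) -> beyond s t x1 y1 x y -> beyond s t x0 y0 x y.
Proof. by move=> h1 h2 [p [c1 o1] [c2 o2]]; split=> //; split=> //; [exact: h1|exact: h2]. Qed.

Lemma crossing_boxP : diagonals kap U P lx ly -> exists sg xs ys, crossing_box sg xs ys.
Proof.
move=> HQ; have [sg sgP] := cofinal_sign HQ.
pose Pr s t x0 y0 := if sg == Some (s == t) then diagonal s t x0 y0 else vacant s t x0 y0.
have Pr_ex s t : exists x0 y0, [/\ on s x0 lx, on t y0 ly & Pr s t x0 y0].
  rewrite /Pr; have [/eqP e|/eqP ne] := boolP (sg == Some (s == t)); first exact/HQ/sgP.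
  by apply: not_cofinal => /sgP.
have Pr_mono s t x0 y0 x1 y1 : (forall v, cls s x1 v -> cls s x0 v) ->
    (forall v, cls t y1 v -> cls t y0 v) -> Pr s t x0 y0 -> Pr s t x1 y1.
  move=> h1 h2; rewrite /Pr; case: ifP => _.
    by move=> d x y x' y' b b'; apply: d; exact: beyond_trans h1 h2 _.
  by move=> v x y b; apply: (v x y); exact: beyond_trans h1 h2 b.
have [x1 [y1 [ox1 oy1 P1]]] := Pr_ex true true.
have [x2 [y2 [ox2 oy2 P2]]] := Pr_ex true false.
have [x3 [y3 [ox3 oy3 P3]]] := Pr_ex false true.
have [x4 [y4 [ox4 oy4 P4]]] := Pr_ex false false.
have [xt [oxt xtP]] := closest2 ox1 ox2; have [xf [oxf xfP]] := closest2 ox3 ox4.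
have [yt [oyt ytP]] := closest2 oy1 oy3; have [yf [oyf yfP]] := closest2 oy2 oy4.
exists sg, (fun s => if s then xt else xf), (fun t => if t then yt else yf); split; try by case.
move=> s t; suff H : Pr s t (if s then xt else xf) (if t then yt else yf).
  by move: H; rewrite /Pr; case: eqP => // /sgP c d; split.
case: s t => [] [].
- by apply: Pr_mono P1 => v; [move/xtP|move/ytP]; case.
- by apply: Pr_mono P2 => v; [move/xtP|move/yfP]; case.
- by apply: Pr_mono P3 => v; [move/xfP|move/ytP]; case.
- by apply: Pr_mono P4 => v; [move/xfP|move/yfP]; case.
Qed.

Lemma in_box_beyond xs ys s t x y : (forall s, on s (xs s) lx) -> (forall t, on t (ys t) ly) ->
  beyond s t (xs s) (ys t) x y -> \ae_ U w, in_box xs ys (kap w) (x (kap w)) (y (kap w)).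
Proof.
move=> onx ony [p [cx ox] [cy oy]].
have cx' := on_cls ox (onx (~~ s)); have cy' := on_cls oy (ony (~~ t)).
apply: filterS (ae_and p (ae_and (ae_and cx cx') (ae_and cy cy'))) => w [pw [[c1 c1'] [c2 c2']]].
split=> //; [move: c1 c1'; rewrite /closer; case: (s)|move: c2 c2'; rewrite /closer; case: (t)];
  by move=> /= -> ->.
Qed.

(** The chain read as a function: [f k a] is the greatest height of a box point on the low part of
    the chain, as delimited by [a]. It passes [ly] exactly when [a] passes [lx], because the chain
    is cofinal above [ly]. *)
Lemma transfer sg xs ys (B : num) : (forall k x y, P k x y -> y < B k) ->
  crossing_box (Some sg) xs ys ->
  exists f : K -> nat -> nat, forall s a, on s a lx -> on (s == sg) (fun k => f k (a k)) ly.
Proof.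
move=> PB [onx ony dv].
pose C k a y := exists x, in_box xs ys k x y /\ if sg then x <= a else a <= x.
have fP k a : exists m, (m = 0 \/ C k a m) /\ forall y, C k a y -> y <= m.
  pose c y := (y == 0) || `[< C k a y >].
  have c0 : exists y, c y by exists 0.
  have cB y : c y -> y <= B k.
    by case/orP => [/eqP->//|/asboolP[x [[/PB/ltnW]]]].
  case: (ex_maxnP c0 cB) => m /orP cm mmax; exists m; split.
    by case: cm => [/eqP|/asboolP]; [left|right].
  by move=> y cy; apply: mmax; rewrite /c asboolT ?orbT.
have /choice[f fQ] : forall k, exists g : nat -> nat, forall a,
    (g a = 0 \/ C k a (g a)) /\ forall y, C k a y -> y <= g a.
  by move=> k; have [g gP] := choice (fP k); exists g.
exists f => s a ona; pose fa k := f k (a k).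
have [ss|ss] := eqVneq s sg.
  (* The default height 0 is below [ly], since an external line is not 0. *)
  have [f0|fn0] := ae_or U (fun w => fa (kap w) = 0).
    by apply: filterS2 f0 (ey (fun=> 0)) => w; rewrite /fa /side => ->; lia.
  have [x xP] : exists x : num, \ae_ U w, in_box xs ys (kap w) (x (kap w)) (fa (kap w)) /\
      if sg then x (kap w) <= a (kap w) else a (kap w) <= x (kap w).
    apply: (choose_internal (A := fun k x => in_box xs ys k x (fa k) /\
      if sg then x <= a k else a k <= x) 0).
    by apply: filterS fn0 => w; have [[]] := fQ (kap w) (a (kap w)).
  have onsx : on s x lx.
    by rewrite ss in ona *; apply: filterS2 xP ona => w [_]; rewrite /side; case: (sg); lia.
  have [//|ony'] := on_or kap U true fa ly; exfalso.
  have := dv s false; rewrite -ss; case: eqP => [[]|_ v]; first by case: (s).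
  by apply: (v x fa); apply: beyond_in_box => //; apply: filterS xP => w [].
have := dv s false; case: eqP => [_ [cof _]|[]]; last by congr Some; move: ss; case: (s); case: (sg).
have [z [onz zP]] := closest2 ona (onx s).
have [x [y [pxy [zx ox] [yy oy]]]] := cof _ _ onz (ony false).
have [ax xx] := zP _ zx.
have ib : \ae_ U w, in_box xs ys (kap w) (x (kap w)) (y (kap w)).
  by apply: (in_box_beyond (s := s) (t := false)).
have le : \ae_ U w, y (kap w) <= fa (kap w).
  apply: filterS2 ib ax => w bxy ax; have [_] := fQ (kap w) (a (kap w)); apply.
  exists (x (kap w)); split=> //; move: ax; rewrite /closer.
  by move: ss; case: (s); case: (sg) => // _ /ltnW.
by apply: filterS2 le oy => w; rewrite /side /fa /=; lia.
Qed.

(** The chain has a point on either side of the crossing between [lo] and [hi]. The heights of these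
    two points bound the new interval, and any [b] between them is matched where the chain passes
    it. *)
Lemma curve_step sg xs ys lo hi : crossing_box (Some sg) xs ys ->
  (\ae_ U w, lo (kap w) <= lx w <= hi (kap w)) ->
  exists lo' hi', (\ae_ U w, lo' (kap w) <= ly w <= hi' (kap w)) /\
    \ae_ U w, forall b, lo' (kap w) <= b <= hi' (kap w) ->
      exists a, lo (kap w) <= a <= hi (kap w) /\ on_curve P (Some sg) xs ys (kap w) a b.
Proof.
move=> cb lh; have [onx ony dv] := cb.
have onlo : on true lo lx by apply: filterS2 lh (ex lo) => w; rewrite /side; lia.
have onhi : on false hi lx by apply: filterS lh => w /andP[].
have [zl [onzl zlP]] := closest2 onlo (onx true).
have [zh [onzh zhP]] := closest2 onhi (onx false).
have := dv true sg; rewrite (_ : true == sg = sg); last by case: (sg).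
rewrite eqxx => -[c1 _].
have := dv false (~~ sg); rewrite (_ : false == ~~ sg = sg); last by case: (sg).
rewrite eqxx => -[c2 _].
have [px [py pb]] := c1 _ _ onzl (ony sg); have [qx [qy qb]] := c2 _ _ onzh (ony (~~ sg)).
have [_ [lp opx] [cpy opy]] := pb; have [_ [hq oqx] [cqy oqy]] := qb.
have [lop xp] := zlP _ lp; have [hiq xq] := zhP _ hq.
have pin : \ae_ U w, in_box xs ys (kap w) (px (kap w)) (py (kap w)).
  by apply: (in_box_beyond (s := true) (t := sg)) => //; case: pb.
have qin : \ae_ U w, in_box xs ys (kap w) (qx (kap w)) (qy (kap w)).
  by apply: (in_box_beyond (s := false) (t := ~~ sg)) => //; case: qb.
exists (fun k => if sg then (py k).+1 else (qy k).+1), (fun k => if sg then qy k else py k).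
split.
  by apply: filterS2 opy oqy => w; rewrite /side; case: (sg) => /=; lia.
apply: filterS3 (box_monotone cb) (ae_and pin qin) (ae_and lop hiq).
move=> w mono [pw qw] [lw hw] b bb.
have [pyb qyb] : side sg (py (kap w)) b /\ side (~~ sg) (qy (kap w)) b.
  by move: bb; rewrite /side; case: (sg) => /=; lia.
(* The line [a] is put just before the leftmost chain point on side [~~ sg] of [b]. *)
pose A x := `[< exists y, in_box xs ys (kap w) x y /\ side (~~ sg) y b >].
have exA : exists x, A x by exists (qx (kap w)); apply/asboolP; exists (qy (kap w)).
case: (ex_minnP exA) => a /asboolP[ay [ain ayb]] amin; exists a; split.
  apply/andP; split; last first.
    apply: (@leq_trans (qx (kap w))); last by move: hw; rewrite /closer; lia.
    by apply: amin; apply/asboolP; exists (qy (kap w)).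
  apply: (@leq_trans (px (kap w))); first by move: lw; rewrite /closer; lia.
  rewrite leqNgt; apply/negP => ap; have := mono _ _ _ _ ain pw ap.
  by move: pyb ayb; rewrite /side /closer; case: (sg) => /=; lia.
move=> x y xin; rewrite [side true _ _]/=; case: ltngtP => [xa|ax|xa].
- apply/esym; apply: contraTT xa => nb; rewrite -leqNgt; apply: amin; apply/asboolP; exists y.
  by split=> //; move: nb; rewrite /side; case: (sg) => /=; lia.
- have := mono _ _ _ _ ain xin ax; move: ayb; rewrite /side /closer; case: (sg) => /=; lia.
- case: xin ain; rewrite xa => p1 _ _ [p2 _ _]; rewrite (Pfun p1 p2).
  by move: ayb; rewrite /side; case: (sg) => /=; lia.
Qed.

End Crossing.

Lemma on_curve_tr K (P : K -> nat -> nat -> Prop) sg xs ys k a b :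
  on_curve (fun k x y => P k y x) (Some sg) ys xs k b a -> on_curve P (Some sg) xs ys k a b.
Proof.
move=> H x y [p hx hy]; have {}H : side true y b = side sg x a by apply: H.
by move: H; rewrite /side; case: (sg) => // H; lia.
Qed.


(** * Conditions on one corner of a cell that survive moving its lines *)

Definition les s x y := ~~ closer s y x.

Section Strip.
Variables (K Omega : Type) (kap : Omega -> K) (U : ultrafilter Omega).
Local Notation num := (K -> nat).
Local Notation on := (on kap U).

Lemma les_on s x y l : (\ae_ U w, les s (x (kap w)) (y (kap w))) -> on s y l -> on s x l.
Proof.
by move=> H1 H2; apply: filterS2 H1 H2 => w; rewrite /les /closer /side; case: s => /=; lia.
Qed.

Lemma strip (T : Type) (t0 : T) s l (C : K -> nat -> T -> Prop) : bounded_line kap U l ->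
  (forall y z, on s y l -> (\ae_ U w, C (kap w) (y (kap w)) (z (kap w))) -> False) ->
  near_line kap U l (fun k b => forall y z, side s y b -> C k y z -> False).
Proof.
move=> bl H; have := spill (s := s) (Q := fun k y => forall z, C k y z -> False) bl.
case=> [y ony|lo [hi [lh nr]]].
  by apply: (internalize (A := fun k z => C k (y k) z) (B := fun _ _ => False) t0) => z /(H _ _ ony).
by exists lo, hi; split=> //; apply: filterS nr => w h x xl y z sy; apply: (h x xl y sy).
Qed.

(** Almost everywhere [l] is an internal number [c], whose neighbouring positions are [c - 1] and
    [c]; [x0] ensures that [c] is not 0 when [s] is [true]. *)
Lemma last_position s x0 l : ~ external kap U l -> on s x0 l -> exists xa, on s xa l /\
  near_line kap U l (fun k a => forall x, closer s (xa k) x -> side s x a -> False).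
Proof.
move=> /existsNP[c nc] onx.
have lc : \ae_ U w, l w = c (kap w).
  by have [//|n] := ae_or U (fun w => l w = c (kap w)); case: nc; apply: filterS n => w /eqP.
exists (fun k => if s then (c k).-1 else c k); split.
  by apply: filterS2 lc onx => w; rewrite /side; case: (s); lia.
exists c, c; split; first by apply: filterS lc => w ->; rewrite !leqnn.
apply: filterS2 lc onx => w lcw + a; rewrite -eqn_leq => + /eqP <- x.
by rewrite /side /closer; case: (s); lia.
Qed.

End Strip.

Section Corners.
Variables (K Omega : Type) (kap : Omega -> K) (U : ultrafilter Omega).
Variables (P : K -> nat -> nat -> Prop) (lx ly : Omega -> nat).

Local Notation num := (K -> nat).
Local Notation on := (on kap U).
Local Notation cls := (cls kap U).
Local Notation point := (point kap U P).
Local Notation beyond := (beyond kap U P lx ly).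
Local Notation cofinal := (cofinal kap U P lx ly).
Local Notation vacant := (vacant kap U P lx ly).
Local Notation crossing_box := (crossing_box kap U P lx ly).
Local Notation in_box := (in_box P).

Hypotheses (Pfun : forall k x y y', P k x y -> P k x y' -> y = y').
Hypotheses (bx : bounded_line kap U lx) (by_ : bounded_line kap U ly).

Definition near_pair (Q : K -> nat -> nat -> Prop) := exists lo hi lo' hi' : num,
  [/\ \ae_ U w, lo (kap w) <= lx w <= hi (kap w), \ae_ U w, lo' (kap w) <= ly w <= hi' (kap w) &
      \ae_ U w, forall a b, lo (kap w) <= a <= hi (kap w) -> lo' (kap w) <= b <= hi' (kap w) ->
        Q (kap w) a b].

Lemma near_pairS (Q R : K -> nat -> nat -> Prop) :
  (forall k a b, Q k a b -> R k a b) -> near_pair Q -> near_pair R.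
Proof.
move=> QR [lo [hi [lo' [hi' [h1 h2 h3]]]]]; exists lo, hi, lo', hi'; split=> //.
by apply: filterS h3 => w h a b ha hb; apply: QR; apply: h.
Qed.

Lemma near_pairI (Q R : K -> nat -> nat -> Prop) :
  near_pair Q -> near_pair R -> near_pair (fun k a b => Q k a b /\ R k a b).
Proof.
move=> [a1 [b1 [c1 [d1 [h1 h2 h3]]]]] [a2 [b2 [c2 [d2 [g1 g2 g3]]]]].
exists (fun k => maxn (a1 k) (a2 k)), (fun k => minn (b1 k) (b2 k)),
  (fun k => maxn (c1 k) (c2 k)), (fun k => minn (d1 k) (d2 k)); split.
- by apply: filterS2 h1 g1 => w; lia.
- by apply: filterS2 h2 g2 => w; lia.
- by apply: filterS2 h3 g3 => w h g a b ha hb; split; [apply: h|apply: g]; lia.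
Qed.

Lemma near_pair_x Q : near_line kap U lx Q -> near_pair (fun k a b => Q k a).
Proof.
move=> [lo [hi [h1 h2]]]; have [B lB] := by_; exists lo, hi, (fun=> 0), B; split=> //.
by apply: filterS h2 => w h a b ha _; apply: h.
Qed.

Lemma near_pair_y Q : near_line kap U ly Q -> near_pair (fun k a b => Q k b).
Proof.
move=> [lo [hi [h1 h2]]]; have [B lB] := bx; exists (fun=> 0), B, lo, hi; split=> //.
by apply: filterS h2 => w h a b _; apply: h.
Qed.

Lemma near_pair_const (Q : K -> Prop) : (\ae_ U w, Q (kap w)) -> near_pair (fun k _ _ => Q k).
Proof.
move=> h; have [B lB] := bx; have [B' lB'] := by_; exists (fun=> 0), B, (fun=> 0), B'; split=> //.
by apply: filterS h => w h a b _ _.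
Qed.

Section Corner.
Variables (s t : bool) (x0 y0 : num).
(* The quadrant between the anchor [(x0, y0)], a point or a position inside a cell, and the
   crossing of the two lines that bound the cell on its sides [s] and [t]. *)
Definition reg x y := [/\ point x y, \ae_ U w, les s (x0 (kap w)) (x (kap w)), on s x lx,
  \ae_ U w, les t (y0 (kap w)) (y (kap w)) & on t y ly].

Definition in_reg k a b x y :=
  [/\ P k x y, les s (x0 k) x, side s x a, les t (y0 k) y & side t y b].

Definition past (xa ya : num) k a b x y :=
  [/\ P k x y, closer s (xa k) x, side s x a, closer t (ya k) y & side t y b].

Definition monotone_reg k a b := forall x y x' y',
  in_reg k a b x y -> in_reg k a b x' y' -> closer s x x' -> closer t y y'.

Definition vacant_reg (bad : K -> nat -> nat -> Prop) k a b := forall x y,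
  in_reg k a b x y -> bad k x y -> False.

(** A bad point that is not past the anchor in both coordinates stays away from one of the two
    lines, so overspill at the other line alone excludes it. *)
Lemma vacant_corner (bad : K -> nat -> nat -> Prop) xa ya :
  on s xa lx -> on t ya ly ->
  (forall x y, reg x y -> (\ae_ U w, bad (kap w) (x (kap w)) (y (kap w))) -> False) ->
  near_pair (fun k a b => (forall x y, past xa ya k a b x y -> False) -> vacant_reg bad k a b).
Proof.
move=> onxa onya H.
have S1 := strip 0 (s := t) (C := fun k y x => [/\ P k x y, bad k x y, les s (x0 k) x,
  les s x (xa k) & les t (y0 k) y]) by_.
have {}S1 := near_pair_y (S1 _).
have S2 := strip 0 (s := s) (C := fun k x y => [/\ P k x y, bad k x y, les t (y0 k) y,
  les t y (ya k) & les s (x0 k) x]) bx.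
have {}S2 := near_pair_x (S2 _).
apply: near_pairS (near_pairI (S1 _) (S2 _)) => [k a b [h1 h2] emp x y|y x ony h|x y onx h].
- move=> [p lx0 sx ly0 sy] bd; have [l1|l1] := boolP (les s x (xa k)).
    by apply: (h1 y x).
  have [l2|l2] := boolP (les t y (ya k)); first by apply: (h2 x y).
  by apply: (emp x y); split=> //; apply: negbNE.
- apply: (H x y); last by apply: filterS h => w [].
  by split=> //; [| |apply: les_on onxa|]; apply: filterS h => w [].
- apply: (H x y); last by apply: filterS h => w [].
  by split=> //; [| | |apply: les_on onya]; apply: filterS h => w [].
Qed.

Hypothesis Dext : forall x y x' y', reg x y -> reg x' y' -> cls s x x' -> cls t y y'.

(* Points with [x] up to [xa] and points with [y] up to [ya] form an L; its two arms contradict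
   monotonicity, so one of them is empty up to the lines and then, by overspill, past them. *)
Lemma diagonal_corner_vacant xa ya : on s xa lx -> on t ya ly ->
  near_pair (fun k a b => (forall x y, past xa ya k a b x y -> False) -> monotone_reg k a b).
Proof.
move=> onxa onya.
(* An inversion inside one arm: of its four coordinates only [y], the height farther towards [ly],
   has to be carried past a line. *)
pose C1 k y (z : nat * (nat * nat)) := [/\ [/\ P k z.1 y, les s (x0 k) z.1 & les s z.1 (xa k)],
  [/\ P k z.2.1 z.2.2, les s (x0 k) z.2.1 & les s z.2.1 (xa k)], les t (y0 k) y /\ les t (y0 k) z.2.2,
  closer s z.1 z.2.1 & les t z.2.2 y].
have S1 : near_line kap U ly (fun k b => forall y z, side t y b -> C1 k y z -> False).
  apply: (strip (0, (0, 0)) (C := C1) by_) => y z ony h.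
  pose x k := (z k).1; pose x' k := (z k).2.1; pose y' k := (z k).2.2.
  have : cls t y y'.
    apply: (Dext (x := x) (x' := x')); last by apply: filterS h => w [].
      split=> //; try by apply: filterS h => w [[? ? ?] [? ? ?] [? ?] ? ?].
      by apply: les_on onxa; apply: filterS h => w [[? ? ?] [? ? ?] [? ?] ? ?].
    split=> //; try by apply: filterS h => w [[? ? ?] [? ? ?] [? ?] ? ?].
      by apply: les_on onxa; apply: filterS h => w [[? ? ?] [? ? ?] [? ?] ? ?].
    by apply: les_on ony; apply: filterS h => w [[? ? ?] [? ? ?] [? ?] ? ?].
  move=> c; apply: (@ae_False _ U); apply: filterS2 h c => w [_ _ _ _].
  by rewrite /les /y' => /negPf ->.
pose C2 k x (z : (nat * nat) * nat) := [/\ [/\ P k z.1.1 z.1.2, les t (y0 k) z.1.2 & les t z.1.2 (ya k)],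
  [/\ P k x z.2, les t (y0 k) z.2 & les t z.2 (ya k)], les s (x0 k) x /\ les s (x0 k) z.1.1,
  closer s z.1.1 x & les t z.2 z.1.2].
have S2 : near_line kap U lx (fun k a => forall x z, side s x a -> C2 k x z -> False).
  apply: (strip ((0, 0), 0) (C := C2) bx) => x' z onx h.
  pose x k := (z k).1.1; pose y k := (z k).1.2; pose y' k := (z k).2.
  have xx' : cls s x x' by apply: filterS h => w [].
  have : cls t y y'.
    apply: (Dext (x := x) (x' := x')) => //.
      split=> //; try by apply: filterS h => w [[? ? ?] [? ? ?] [? ?] ? ?].
        exact: cls_on xx' onx.
      by apply: les_on onya; apply: filterS h => w [[? ? ?] [? ? ?] [? ?] ? ?].
    split=> //; try by apply: filterS h => w [[? ? ?] [? ? ?] [? ?] ? ?].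
    by apply: les_on onya; apply: filterS h => w [[? ? ?] [? ? ?] [? ?] ? ?].
  move=> c; apply: (@ae_False _ U); apply: filterS2 h c => w [_ _ _ _].
  by rewrite /les /y' => /negPf ->.
pose arm1 k y x := [/\ P k x y, les s (x0 k) x, les s x (xa k), les t (y0 k) y & closer t (ya k) y].
pose arm2 k x y := [/\ P k x y, les t (y0 k) y, les t y (ya k), les s (x0 k) x & closer s (xa k) x].
have A : near_pair (fun k a b => (forall y x, side t y b -> arm1 k y x -> False) \/
    (forall x y, side s x a -> arm2 k x y -> False)).
  have [[y [x [ony h1]]]|n1] := pselect (exists y x, on t y ly /\
      \ae_ U w, arm1 (kap w) (y (kap w)) (x (kap w))).
    apply: near_pairS (near_pair_x (strip 0 (s := s) (C := arm2) bx _)) => [k a b h|x' y' onx' h2].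
      by right; exact: h.
    have : cls t y y'.
      apply: (Dext (x := x) (x' := x')).
      - by split=> //; [| |apply: les_on onxa|]; apply: filterS h1 => w [].
      - by split=> //; [| | |apply: les_on onya]; apply: filterS h2 => w [].
      apply: filterS2 h1 h2 => w [_ _ + _ _] [_ _ _ _].
      by rewrite /les /closer; case: (s); lia.
    move=> c; apply: (@ae_False _ U); apply: filterS3 h1 h2 c => w [_ _ _ _ +] [_ _ + _ _].
    by rewrite /les /closer; case: (t); lia.
  apply: near_pairS (near_pair_y (strip 0 (s := t) (C := arm1) by_ _)) => [k a b h|y x ony h].
    by left; exact: h.
  by apply: n1; exists y, x.
apply: near_pairS (near_pairI A (near_pairI (near_pair_y S1) (near_pair_x S2))).
move=> k a b [arms [h1 h2]] emp x y x' y' [p lx0 sx ly0 sy] [p' lx0' sx' ly0' sy'] cx.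
apply/negbNE/negP => nc.
have [l1'|l1'] := boolP (les s x' (xa k)).
  have l1 : les s x (xa k) by move: cx l1'; rewrite /les /closer; case: (s); lia.
  by apply: (h1 y (x, (x', y'))) => //; split.
have [l2|l2] := boolP (les t y (ya k)).
  have l2' : les t y' (ya k) by move: nc l2; rewrite /les /closer; case: (t); lia.
  by apply: (h2 x' ((x, y), y')) => //; split.
have [l1|l1] := boolP (les s x (xa k)); last first.
  by apply: (emp x y); split=> //; exact: negbNE.
have [l2'|l2'] := boolP (les t y' (ya k)); last first.
  by apply: (emp x' y'); split=> //; exact: negbNE.
case: arms => [arm|arm]; first by apply: (arm y x) => //; split=> //; exact: negbNE.
by apply: (arm x' y') => //; split=> //; exact: negbNE.
Qed.

(** Compared with the point [z] itself, no point of the region is past [z] in one coordinate only.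
    Pairs of points up to [z] stay away from both lines, so only pairs past [z] remain to be
    assumed. *)
Lemma diagonal_corner_cofinal zx zy : reg zx zy ->
  near_pair (fun k a b => (forall x y x' y', past zx zy k a b x y -> past zx zy k a b x' y' ->
    closer s x x' -> closer t y y') -> monotone_reg k a b).
Proof.
move=> zreg; have [pz lzx onzx lzy onzy] := zreg.
pose C1 k y x := [/\ P k x y, les s (x0 k) x, les s x (zx k) & closer t (zy k) y].
have S1 : near_line kap U ly (fun k b => forall y z, side t y b -> C1 k y z -> False).
  apply: (strip 0 (C := C1) by_) => y x ony h.
  have zyy : cls t zy y by apply: filterS h => w [].
  have rg : reg x y.
    split=> //; try by apply: filterS h => w [].
      by apply: les_on onzx; apply: filterS h => w [].
    by apply: filterS2 lzy zyy => w; rewrite /les /closer; case: (t); lia.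
  have [eq|ne] := ae_or U (fun w => x (kap w) = zx (kap w)).
    apply: (@ae_False _ U); case: rg => p _ _ _ _.
    apply: filterS2 (ae_and eq pz) (ae_and p zyy) => w [-> p1] [p2].
    by rewrite (Pfun p1 p2) /closer ltnn; case: (t).
  apply: cls_asym zyy (clsN (Dext rg zreg _)).
  apply: filterS2 ne h => w + [_ _ + _].
  by rewrite /les /closer; case: (s); lia.
pose C2 k x y := [/\ P k x y, les t (y0 k) y, les t y (zy k) & closer s (zx k) x].
have S2 : near_line kap U lx (fun k a => forall x y, side s x a -> C2 k x y -> False).
  apply: (strip 0 (C := C2) bx) => x y onx h.
  have zxx : cls s zx x by apply: filterS h => w [].
  have rg : reg x y.
    split=> //; try by apply: filterS h => w [].
      by apply: filterS2 lzx zxx => w; rewrite /les /closer; case: (s); lia.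
    by apply: les_on onzy; apply: filterS h => w [].
  apply: (@ae_False _ U); apply: filterS2 h (Dext zreg rg zxx) => w [_ _ + _].
  by rewrite /les => /negPf ->.
pose A k (r : (nat * nat) * (nat * nat)) :=
  [/\ [/\ P k r.1.1 r.1.2, les s (x0 k) r.1.1, les s r.1.1 (zx k), les t (y0 k) r.1.2 & les t r.1.2 (zy k)],
      [/\ P k r.2.1 r.2.2, les s (x0 k) r.2.1, les s r.2.1 (zx k), les t (y0 k) r.2.2 & les t r.2.2 (zy k)]
    & closer s r.1.1 r.2.1].
have base : \ae_ U w, forall r, A (kap w) r -> closer t r.1.2 r.2.2.
  apply: (internalize (A := A) (B := fun k r => closer t r.1.2 r.2.2) ((0, 0), (0, 0))) => r h.
  apply: (Dext (x := fun k => (r k).1.1) (x' := fun k => (r k).2.1)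
    (y := fun k => (r k).1.2) (y' := fun k => (r k).2.2)); last by apply: filterS h => w [].
  - by split; [| |apply: les_on onzx| |apply: les_on onzy]; apply: filterS h => w [[]].
  - by split; [| |apply: les_on onzx| |apply: les_on onzy]; apply: filterS h => w [_ []].
apply: near_pairS (near_pairI (near_pair_const (Q := fun k => forall r, A k r -> closer t r.1.2 r.2.2) base)
  (near_pairI (near_pair_y S1) (near_pair_x S2))).
move=> k a b [bs [h1 h2]] mono x y x' y' [p lx0 sx ly0 sy] [p' lx0' sx' ly0' sy'] cx.
have split_reg u v : P k u v -> les s (x0 k) u -> side s u a -> les t (y0 k) v -> side t v b ->
    (les s u (zx k) /\ les t v (zy k)) \/ past zx zy k a b u v.
  move=> puv lu su lv sv.
  have [l1|l1] := boolP (les s u (zx k)); have [l2|l2] := boolP (les t v (zy k)).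
  - by left.
  - by exfalso; apply: (h1 v u) => //; split=> //; exact: negbNE.
  - by exfalso; apply: (h2 u v) => //; split=> //; exact: negbNE.
  - by right; split=> //; exact: negbNE.
have [[l1 l2]|ps] := split_reg x y p lx0 sx ly0 sy.
  have [[l1' l2']|[_ _ _ c' _]] := split_reg x' y' p' lx0' sx' ly0' sy'.
    by apply: (bs ((x, y), (x', y'))).
  by move: l2 c'; rewrite /les /closer; case: (t); lia.
have [[l1' l2']|ps'] := split_reg x' y' p' lx0' sx' ly0' sy'; last exact: mono ps ps' cx.
by case: ps => _ c _ _ _; move: c cx l1'; rewrite /les /closer; case: (s); lia.
Qed.

End Corner.
End Corners.


Section CornerConditions.
Variables (K Omega : Type) (kap : Omega -> K) (U : ultrafilter Omega).
Variables (P : K -> nat -> nat -> Prop) (lx ly : Omega -> nat).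

Local Notation num := (K -> nat).
Local Notation on := (on kap U).
Local Notation cls := (cls kap U).
Local Notation beyond := (beyond kap U P lx ly).
Local Notation cofinal := (cofinal kap U P lx ly).
Local Notation crossing_box := (crossing_box kap U P lx ly).
Local Notation near_pair := (near_pair kap U lx ly).

Hypotheses (Pfun : forall k x y y', P k x y -> P k x y' -> y = y').
Hypotheses (bx : bounded_line kap U lx) (by_ : bounded_line kap U ly).

Lemma past_in_box xs ys s t : (forall s, on s (xs s) lx) -> (forall t, on t (ys t) ly) ->
  near_pair (fun k a b => forall x y, past P s t (xs s) (ys t) k a b x y -> in_box P xs ys k x y).
Proof.
move=> onx ony; exists (fun k => (xs true k).+1), (xs false), (fun k => (ys true k).+1), (ys false).
split.
- by apply: filterS2 (onx true) (onx false) => w; rewrite /side; lia.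
- by apply: filterS2 (ony true) (ony false) => w; rewrite /side; lia.
apply: nearW => w a b ha hb x y [p c1 s1 c2 s2]; split=> //.
  by move: c1 s1; rewrite /closer /side; case: (s); lia.
by move: c2 s2; rewrite /closer /side; case: (t); lia.
Qed.

Lemma past_vacant sg xs ys s t : crossing_box sg xs ys -> sg != Some (s == t) ->
  near_pair (fun k a b => on_curve P sg xs ys k a b ->
    forall x y, past P s t (xs s) (ys t) k a b x y -> False).
Proof.
move=> cb ne; have [onx ony _] := cb; case: sg cb ne => [sg|] cb ne.
  apply: near_pairS (past_in_box s t onx ony) => k a b ib cv x y /[dup] /ib /cv.
  move=> + [_ _ sx _ sy]; move: sx sy ne; rewrite /side.
  by case: (s); case: (t); case: (sg) => //=; lia.
apply: near_pairS (near_pairI (past_in_box s t onx ony)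
  (near_pair_const bx by_ (Q := fun k => forall x y, ~ in_box P xs ys k x y) (box_none cb))).
by move=> k a b [ib nb] _ x y /ib /nb.
Qed.

Section AtCorner.
Variables (s t : bool) (x0 y0 : num).
Hypotheses (onx0 : on s x0 lx) (ony0 : on t y0 ly).
Local Notation reg := (reg kap U P lx ly s t x0 y0).

Lemma beyond_reg x y : beyond s t x0 y0 x y -> reg x y.
Proof.
case=> p [c1 o1] [c2 o2]; split=> //.
  by apply: filterS c1 => w; rewrite /les /closer; case: (s); lia.
by apply: filterS c2 => w; rewrite /les /closer; case: (t); lia.
Qed.

(** In a quadrant that carries the chain, pairs past a chain point inherit monotonicity from the
    box; in any other quadrant the curve condition leaves no point past the corner of the box. *)
Lemma monotone_corner_curve sg xs ys : crossing_box sg xs ys ->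
  (forall x y x' y', reg x y -> reg x' y' -> cls s x x' -> cls t y y') ->
  near_pair (fun k a b => on_curve P sg xs ys k a b -> monotone_reg P s t x0 y0 k a b).
Proof.
move=> cb D; have [onx ony cv] := cb.
have [e|ne] := eqVneq sg (Some (s == t)); last first.
  apply: near_pairS (near_pairI (past_vacant cb ne)
    (diagonal_corner_vacant bx by_ D (onx s) (ony t))) => k a b [h1 h2] /h1; exact: h2.
have := cv s t; rewrite e eqxx => -[cof _].
have [xa [onxa xaP]] := closest2 onx0 (onx s); have [ya [onya yaP]] := closest2 ony0 (ony t).
have [zx [zy [pz [cx onzx] [cy onzy]]]] := cof _ _ onxa onya.
have [cx0 cxs] := xaP _ cx; have [cy0 cys] := yaP _ cy.
have zreg : reg zx zy by apply: beyond_reg.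
rewrite e in cb.
have c1 := near_pair_const bx by_ (Q := fun k => forall x y x' y', in_box P xs ys k x y ->
  in_box P xs ys k x' y' -> x < x' -> closer (s == t) y y') (box_monotone cb).
have c2 := near_pair_const bx by_ (Q := fun k => closer s (xs s k) (zx k) /\ closer t (ys t k) (zy k))
  (ae_and cxs cys).
apply: near_pairS (near_pairI (near_pairI c1 c2) (near_pairI (past_in_box s t onx ony)
  (diagonal_corner_cofinal Pfun bx by_ D zreg))).
move=> k a b [[mono [zc1 zc2]] [ib concl]] _; apply: concl => x y x' y' h h'.
have pst u v : past P s t zx zy k a b u v -> past P s t (xs s) (ys t) k a b u v.
  case=> p q1 q2 q3 q4; split=> //.
    by move: zc1 q1; rewrite /closer; case: (s); lia.
  by move: zc2 q3; rewrite /closer; case: (t); lia.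
move: (mono _ _ _ _ (ib _ _ (pst _ _ h)) (ib _ _ (pst _ _ h'))).
move: (mono _ _ _ _ (ib _ _ (pst _ _ h')) (ib _ _ (pst _ _ h))).
by rewrite /closer; case: (s); case: (t) => //=; lia.
Qed.

(** A cofinal quadrant would contain points beyond the anchor, and these are bad; so the chain
    avoids this quadrant. *)
Lemma vacant_corner_curve sg xs ys (bad : K -> nat -> nat -> Prop) : crossing_box sg xs ys ->
  (forall x y, beyond s t x0 y0 x y -> \ae_ U w, bad (kap w) (x (kap w)) (y (kap w))) ->
  (forall x y, reg x y -> (\ae_ U w, bad (kap w) (x (kap w)) (y (kap w))) -> False) ->
  near_pair (fun k a b => on_curve P sg xs ys k a b -> vacant_reg P s t x0 y0 bad k a b).
Proof.
move=> cb bb H; have [onx ony cv] := cb.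
have ne : sg != Some (s == t).
  apply/eqP => e; have := cv s t; rewrite e eqxx => -[cof _].
  by have [x [y b]] := cof _ _ onx0 ony0; apply: (H x y); [exact: beyond_reg|exact: bb].
by apply: near_pairS (near_pairI (past_vacant cb ne)
  (vacant_corner bx by_ (onx s) (ony t) H)) => k a b [h1 h2] /h1; exact: h2.
Qed.

Hypothesis nonext : ~ (external kap U lx /\ external kap U ly).

Lemma past_internal : exists xa ya, [/\ on s xa lx, on t ya ly &
  near_pair (fun k a b => forall x y, past P s t xa ya k a b x y -> False)].
Proof.
case/not_andP: nonext => [n|n].
  have [xa [onxa nr]] := last_position n onx0; exists xa, y0; split=> //.
  by apply: near_pairS (near_pair_x by_ nr) => k a b h x y [_ c1 s1 _ _]; apply: h c1 s1.
have [ya [onya nr]] := last_position n ony0; exists x0, ya; split=> //.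
by apply: near_pairS (near_pair_y bx nr) => k a b h x y [_ _ _ c1 s1]; apply: h c1 s1.
Qed.

Lemma monotone_corner_internal :
  (forall x y x' y', reg x y -> reg x' y' -> cls s x x' -> cls t y y') ->
  near_pair (monotone_reg P s t x0 y0).
Proof.
move=> D; have [xa [ya [onxa onya emp]]] := past_internal.
apply: near_pairS (near_pairI emp (diagonal_corner_vacant bx by_ D onxa onya)).
by move=> k a b [h1 h2]; exact: h2.
Qed.

Lemma vacant_corner_internal (bad : K -> nat -> nat -> Prop) :
  (forall x y, reg x y -> (\ae_ U w, bad (kap w) (x (kap w)) (y (kap w))) -> False) ->
  near_pair (vacant_reg P s t x0 y0 bad).
Proof.
move=> H; have [xa [ya [onxa onya emp]]] := past_internal.
apply: near_pairS (near_pairI emp (vacant_corner bx by_ onxa onya H)).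
by move=> k a b [h1 h2]; exact: h2.
Qed.

End AtCorner.
End CornerConditions.


(** * The cuts in one direction, up to indistinguishability *)

Section Cuts.
Variables (K Omega : Type) (kap : Omega -> K) (U : ultrafilter Omega).
Variables (N : nat) (g : Omega -> nat -> nat) (L : K -> nat).
Hypotheses (g0 : \ae_ U w, g w 0 = 0) (gN : \ae_ U w, g w N = L (kap w)).
Hypothesis gmono : \ae_ U w, forall k, k < N -> g w k <= g w k.+1.

Local Notation num := (K -> nat).
Local Notation on := (on kap U).
Local Notation external := (external kap U).

Definition cut (i : 'I_N.+1) (w : Omega) := g w i.
Definition same_cut (i j : 'I_N.+1) := forall s a, on s a (cut i) -> on s a (cut j).
(** Indexed so that strip [c] lies on side [s] of its boundary [s]: [false] is its lower line and
    [true] its upper one. *)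
Definition boundary (c : 'I_N) (s : bool) : 'I_N.+1 := inord (c + s).
Definition thick (c : 'I_N) (a : num) :=
  on false a (cut (boundary c false)) /\ on true a (cut (boundary c true)).
(** Cuts that no internal position separates are moved as one line, so that a strip without internal
    positions remains empty. *)
Definition rep (i : 'I_N.+1) : 'I_N.+1 := [arg min_(j < i | `[< same_cut j i >]) j].

Lemma boundaryE c s : boundary c s = c + s :> nat.
Proof. by rewrite inordK // ltnS; case: s; rewrite ?addn1 ?addn0 // ltnW. Qed.

Lemma cut_le : \ae_ U w, forall i j : 'I_N.+1, i <= j -> cut i w <= cut j w.
Proof.
apply: filterS gmono => w gm i j ij; rewrite /cut.
have jN : j <= N by rewrite -ltnS.
elim: {j}(nat_of_ord j) ij jN => [|j IH]; first by rewrite leqn0 => /eqP->.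
rewrite leq_eqVlt => /orP[/eqP->//|ij] jN.
by apply: leq_trans (IH ij (ltnW jN)) (gm _ jN).
Qed.

Lemma cut_bounded i : bounded_line kap U (cut i).
Proof.
exists L; apply: filterS2 cut_le gN => w cle <-.
by have := cle i ord_max; rewrite /cut /=; apply; rewrite -ltnS.
Qed.

Lemma same_cut_sym i j : same_cut i j -> same_cut j i.
Proof.
move=> h s a oj; have [//|/h n] := on_or kap U s a (cut i).
by case: (on_neg oj n).
Qed.
Arguments same_cut_sym {i j} _.

Lemma same_cut_trans i j l : same_cut i j -> same_cut j l -> same_cut i l.
Proof. by move=> h1 h2 s a /h1/h2. Qed.
Arguments same_cut_trans {i j l} _ _.

Lemma on_le (i j : 'I_N.+1) (a : num) : i <= j -> on true a (cut i) -> on true a (cut j).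
Proof.
by move=> ij H; apply: filterS2 cut_le H => w /(_ _ _ ij); rewrite /side; lia.
Qed.

Lemma same_cut_between (i j l : 'I_N.+1) : i <= j <= l -> same_cut i l -> same_cut i j.
Proof.
move=> /andP[ij jl] h; have h' := same_cut_sym h; case=> a; first exact: on_le.
move=> oi; have [/(on_le jl)/h'|//] := on_or kap U true a (cut j).
by move/on_neg => /(_ oi).
Qed.
Arguments same_cut_between {i j l} _ _.

Lemma rep_same i : same_cut (rep i) i.
Proof. by rewrite /rep; case: arg_minnP => [|j /asboolP//]; apply/asboolP. Qed.
Arguments rep_same i : clear implicits.

Lemma rep_min i j : same_cut j i -> rep i <= j.
Proof.
move=> h; rewrite /rep; case: arg_minnP => [|l _]; first exact/asboolP.
by apply; apply/asboolP.
Qed.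

Lemma rep_le i : rep i <= i.
Proof. exact: rep_min. Qed.

Lemma eq_rep i j : same_cut i j -> rep i = rep j.
Proof.
move=> h; apply/val_inj/eqP; rewrite eqn_leq; apply/andP; split; apply: rep_min.
  exact: same_cut_trans (rep_same j) (same_cut_sym h).
exact: same_cut_trans (rep_same i) h.
Qed.

Lemma rep_idem i : rep (rep i) = rep i.
Proof. exact/eq_rep/rep_same. Qed.

Lemma thin_rep c : ~ (exists a, thick c a) -> rep (boundary c false) = rep (boundary c true).
Proof.
move=> nt; apply: eq_rep; apply: contrapT => ns; apply: nt.
move: ns => /existsNP[s /existsNP[a /not_implyP[oi noj]]].
have le : boundary c false <= boundary c true by rewrite !boundaryE leq_add2l.
have oj : on (~~ s) a (cut (boundary c true)).
  by have [/noj|] := on_or kap U s a (cut (boundary c true)).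
case: s oi noj oj => oi noj oj; first by case: noj; exact: on_le oi.
by exists a.
Qed.

Lemma thick_not_same c a : thick c a -> ~ same_cut (boundary c false) (boundary c true).
Proof. by case=> of_ ot h; apply: on_neg ot (h _ _ of_). Qed.

(** An earlier representative would make the lower boundary, which lies in between,
    indistinguishable from the upper one. *)
Lemma rep_true c a : thick c a -> rep (boundary c true) = c.+1 :> nat.
Proof.
move=> th; apply/eqP; rewrite eqn_leq -{1}(addn1 c) -(boundaryE c true) rep_le /=.
rewrite ltnNge; apply/negP => le; apply: (thick_not_same th).
have h : same_cut (rep (boundary c true)) (boundary c false).
  by apply: same_cut_between (rep_same _); rewrite !boundaryE addn0 le addn1 leqnSn.
exact: same_cut_trans (same_cut_sym h) (rep_same _).
Qed.

Lemma rep_false c : rep (boundary c false) <= c.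
Proof. by have := rep_le (boundary c false); rewrite boundaryE addn0. Qed.

Lemma thick_on c a s : thick c a -> on s a (cut (rep (boundary c s))).
Proof. by case=> o1 o2; case: s; apply: (same_cut_sym (rep_same _)). Qed.

Lemma thick_les c a s x : thick c a -> (\ae_ U w, les s (a (kap w)) (x (kap w))) ->
  on s x (cut (rep (boundary c s))) -> thick c x.
Proof.
case=> o1 o2 le /(rep_same (boundary c s)) ox; case: s le ox => le ox; split=> //.
  by apply: filterS2 o1 le => w; rewrite /side /les /closer; lia.
by apply: filterS2 o2 le => w; rewrite /side /les /closer; lia.
Qed.

Lemma thick_near c a s : thick c a -> near_line kap U (cut (rep (boundary c s)))
  (fun k l => side s (a k) l).
Proof.
move=> th; have := thick_on s th; have [B lB] := cut_bounded (rep (boundary c s)).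
case: s lB => lB h.
  exists (fun k => (a k).+1), B; split; first by apply: filterS2 h lB => w; rewrite /side => -> ->.
  by apply: nearW => w l /andP[].
exists (fun=> 0), a; split; first by apply: filterS h => w.
by apply: nearW => w l /andP[].
Qed.

Lemma not_external0 : ~ external (cut ord0).
Proof. by move/(_ (fun=> 0)) => h; apply: (@ae_False _ U); apply: filterS2 g0 h => w; rewrite /cut /= => ->. Qed.

Lemma not_external_max : ~ external (cut ord_max).
Proof. by move/(_ L) => h; apply: (@ae_False _ U); apply: filterS2 gN h => w; rewrite /cut /= => ->; rewrite eqxx. Qed.

Lemma near_line0 : near_line kap U (cut (rep ord0)) (fun k l => l = 0).
Proof.
have e : rep ord0 = ord0 by apply/val_inj/eqP; rewrite -leqn0; exact: rep_le.
rewrite e; exists (fun=> 0), (fun=> 0); split; first by apply: filterS g0 => w; rewrite /cut /= => ->.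
by apply: nearW => w l; rewrite leqn0 => /andP[_ /eqP].
Qed.

Lemma same_cut_external i j : same_cut i j -> external (cut i) -> external (cut j).
Proof.
move=> h ei a; have [//|n] := ae_or U (fun w => cut j w != a (kap w)).
have {}n : \ae_ U w, cut j w = a (kap w) by apply: filterS n => w /negP/negPn/eqP.
have h' := same_cut_sym h.
have h1 : on false a (cut i) by apply: h'; apply: filterS n => w; rewrite /side => ->.
have [h2|h2] := ae_or U (fun w => 0 < a (kap w)).
  have h3 : on true (fun k => (a k).-1) (cut i).
    by apply: h'; apply: filterS2 n h2 => w; rewrite /side => ->; lia.
  by exfalso; apply: (@ae_False _ U); apply: filterS3 (ei a) h1 (ae_and h3 h2) => w; rewrite /side; lia.
exfalso; apply: (@ae_False _ U); apply: filterS3 (ei a) h1 h2 => w; rewrite /side; lia.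
Qed.

(** The representative may have a smaller index, but it has the internal positions [L] and [L - 1]
    on the same sides as the last cut, which fixes its value. *)
Lemma near_line_max : near_line kap U (cut (rep ord_max)) (fun k l => l = L k).
Proof.
have h := rep_same ord_max.
exists L, L; split; last by apply: nearW => w l; rewrite -eqn_leq => /eqP.
have h1 : on false L (cut (rep ord_max)).
  by apply: (same_cut_sym h); apply: filterS gN => w; rewrite /side /cut /= => ->.
have [h2|h2] := ae_or U (fun w => 0 < L (kap w)).
  have h3 : on true (fun k => (L k).-1) (cut (rep ord_max)).
    by apply: (same_cut_sym h); apply: filterS2 gN h2 => w; rewrite /side /cut /= => ->; lia.
  by apply: filterS3 h1 h3 h2 => w; rewrite /side; lia.
by apply: filterS2 h1 h2 => w; rewrite /side; lia.
Qed.

(** The first and last cuts are not external, so the class of [i] ends before them; the strip next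
    to the class on side [s] is thick. *)
Lemma adjacent_thick i s : external (cut i) -> exists c a, thick c a /\ rep (boundary c s) = rep i.
Proof.
move=> ei.
have ne j : ~ external (cut j) -> ~ same_cut i j by move=> n /same_cut_external/(_ ei).
case: s.
  have r0 : 0 < rep i.
    rewrite lt0n; apply/eqP => r0; apply: (ne ord0 not_external0).
    by apply: same_cut_sym; rewrite (_ : ord0 = rep i); [exact: rep_same|exact/val_inj].
  have cN : (rep i).-1 < N by have := ltn_ord (rep i); lia.
  pose c := Ordinal cN.
  have bt : boundary c true = rep i by apply: val_inj; rewrite /= boundaryE /=; lia.
  have [[a th]|/thin_rep e] := pselect (exists a, thick c a).
    by exists c, a; split=> //; rewrite bt rep_idem.
  exfalso; have := rep_false c; rewrite e bt rep_idem /=; lia.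
pose j := [arg max_(j > i | `[< same_cut j i >]) j].
have [ji jmax] : same_cut j i /\ forall l, same_cut l i -> l <= j.
  rewrite /j; case: arg_maxnP => [|l /asboolP li lm]; first exact/asboolP.
  by split=> // l' /asboolP; exact: lm.
have jN : j < N.
  rewrite ltn_neqAle -ltnS ltn_ord andbT; apply/eqP => e.
  apply: (ne ord_max not_external_max); apply: same_cut_sym.
  by rewrite (_ : ord_max = j) //; exact/val_inj.
pose c := Ordinal jN.
have bf : boundary c false = j by apply: val_inj; rewrite /= boundaryE addn0.
have [[a th]|/thin_rep e] := pselect (exists a, thick c a).
  by exists c, a; split=> //; rewrite bf; exact: eq_rep.
exfalso; suff: boundary c true <= j by rewrite boundaryE addn1 ltnn.
apply: jmax; apply: same_cut_trans (same_cut_sym (rep_same _)) _; rewrite -e bf.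
exact: same_cut_trans (rep_same _) ji.
Qed.

End Cuts.


(** * Limit cells of griddings with one exceptional point *)

Definition sign_entry (sg : bool) : int := if sg then 1%R else (-1)%R.

Lemma sign_entry_inj : injective sign_entry.
Proof. by do 2!case. Qed.

Definition in_cell (L : nat) (p : seq nat) a a' b b' x :=
  (x < L) && (a <= x < a') && (b <= nth 0 p x < b').

Definition cell_ok (e : int) (I : nat -> bool) (p : seq nat) :=
  [/\ e = 0%R -> forall x, ~~ I x,
      e = 1%R -> forall x y, I x -> I y -> x < y -> nth 0 p x < nth 0 p y &
      e = (-1)%R -> forall x y, I x -> I y -> x < y -> nth 0 p x > nth 0 p y].

(** A gridding of [p] minus its point at [d], drawn in the coordinates of [p], so that one plot
    serves for all [d]. *)
Definition gridding_except (m n : nat) (M : 'I_m -> 'I_n -> int) (p : seq nat) (d : nat)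
    (v h : nat -> nat) : Prop :=
  [/\ v 0 = 0, v m = size p & (forall k, k < m -> v k <= v k.+1)] /\
  [/\ h 0 = 0, h n = size p & (forall k, k < n -> h k <= h k.+1)] /\
  (forall (i : 'I_m) (j : 'I_n), cell_ok (M i j)
     (fun x => (x != d) && in_cell (size p) p (v i) (v i.+1) (h j) (h j.+1) x) p).

Section Generic.
Variables (m n : nat) (M : 'I_m -> 'I_n -> int).
Variables (K Omega : Type) (kap : Omega -> K) (U : ultrafilter Omega).
Variables (p : K -> seq nat) (d : Omega -> nat) (v h : Omega -> nat -> nat).
Hypothesis M_entries : gridding_matrix M.
Hypothesis p_perm : forall k, is_perm (p k).
Hypothesis d_generic : forall a : K -> nat, \ae_ U w, a (kap w) != d w.
Hypothesis grid_except : \ae_ U w, gridding_except M (p (kap w)) (d w) (v w) (h w).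

Local Notation num := (K -> nat).
Local Notation on := (on kap U).
Local Notation cls := (cls kap U).

Definition plot k x y := x < size (p k) /\ nth 0 (p k) x = y.
Let L k := size (p k).

Lemma plot_fun k x y y' : plot k x y -> plot k x y' -> y = y'.
Proof. by case=> _ <- [_ <-]. Qed.

Lemma perm_nth_lt s x : is_perm s -> x < size s -> nth 0 s x < size s.
Proof.
move=> ps xs; have := mem_nth 0 xs; rewrite (perm_mem ps) mem_iota add0n; exact.
Qed.

Lemma perm_nth_inj s x y : is_perm s -> x < size s -> y < size s -> nth 0 s x = nth 0 s y -> x = y.
Proof.
move=> ps xs ys /eqP; rewrite nth_uniq //; last by rewrite (perm_uniq ps) iota_uniq.
by move/eqP.
Qed.

Lemma plot_inj k x x' y : plot k x y -> plot k x' y -> x = x'.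
Proof. by case=> xs <- [xs' e]; apply: (perm_nth_inj (p_perm k)). Qed.

Lemma plot_bound k x y : plot k x y -> x < L k /\ y < L k.
Proof. by case=> xs <-; split=> //; exact: perm_nth_lt. Qed.

Lemma v0 : \ae_ U w, v w 0 = 0.
Proof. by apply: filterS grid_except => w [[]]. Qed.
Lemma vL : \ae_ U w, v w m = L (kap w).
Proof. by apply: filterS grid_except => w [[]]. Qed.
Lemma v_mono : \ae_ U w, forall k, k < m -> v w k <= v w k.+1.
Proof. by apply: filterS grid_except => w [[]]. Qed.
Lemma h0 : \ae_ U w, h w 0 = 0.
Proof. by apply: filterS grid_except => w [_ [[]]]. Qed.
Lemma hL : \ae_ U w, h w n = L (kap w).
Proof. by apply: filterS grid_except => w [_ [[]]]. Qed.
Lemma h_mono : \ae_ U w, forall k, k < n -> h w k <= h w k.+1.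
Proof. by apply: filterS grid_except => w [_ [[]]]. Qed.

Local Notation vrep := (rep kap U v).
Local Notation hrep := (rep kap U h).
Local Notation vthick := (thick kap U v).
Local Notation hthick := (thick kap U h).

Definition in_limit_cell (c : 'I_m) (e : 'I_n) x y :=
  [/\ point kap U plot x y, vthick c x & hthick e y].

(** As [x] is internal, it differs from the exceptional position [d] almost everywhere. *)
Lemma in_limit_cellP c e x y : in_limit_cell c e x y -> \ae_ U w,
  (x (kap w) != d w) && in_cell (L (kap w)) (p (kap w)) (v w c) (v w c.+1) (h w e) (h w e.+1) (x (kap w))
  /\ nth 0 (p (kap w)) (x (kap w)) = y (kap w).
Proof.
case=> pxy [vf vt] [hf ht].
apply: filterS3 (ae_and pxy (d_generic x)) (ae_and vf vt) (ae_and hf ht).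
move=> w [[xL xy] xd] [vf' vt'] [hf' ht']; split=> //; rewrite xd /in_cell xL xy /=.
by move: vf' vt' hf' ht'; rewrite /side /cut !boundaryE ?addn0 ?addn1 => -> -> -> ->.
Qed.

Lemma limit_cell_sign c e x y : in_limit_cell c e x y -> exists sg, M c e = sign_entry sg.
Proof.
move=> /in_limit_cellP H; have := M_entries c e.
rewrite !inE => /or3P[] /eqP; [|by exists true|by exists false].
move=> M0; exfalso; apply: (@ae_False _ U); apply: filterS2 grid_except H => w [_ [_ g]] [ic _].
by have [/(_ M0)] := g c e; move=> /(_ (x (kap w))); rewrite ic.
Qed.

Lemma limit_cell_monotone c e sg s x y x' y' : M c e = sign_entry sg ->
  in_limit_cell c e x y -> in_limit_cell c e x' y' -> cls s x x' -> cls (s == sg) y y'.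
Proof.
have main : M c e = sign_entry sg -> forall x y x' y',
    in_limit_cell c e x y -> in_limit_cell c e x' y' -> cls true x x' -> cls sg y y'.
  move=> Me {}x {}y {}x' {}y' /in_limit_cellP H /in_limit_cellP H' lt.
  apply: filterS2 grid_except (ae_and lt (ae_and H H')) => w [_ [_ g]] [xx [[ic <-] [ic' <-]]].
  have [_ g1 g2] := g c e; move: Me; case: (sg) => [/g1|/g2]; exact.
move=> /main {}main H H' lt; have [es|] := boolP s.
  by move: lt; rewrite es => /(main _ _ _ _ H H'); case: (sg).
move/negbTE => es; move: lt; rewrite es => /clsN /(main _ _ _ _ H' H) /clsN.
by case: (sg).
Qed.

Lemma beyond_limit_cell c e a b s t x y : vthick c a -> hthick e b ->
  beyond kap U plot (cut v (vrep (boundary c s))) (cut h (hrep (boundary e t))) s t a b x y ->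
  in_limit_cell c e x y.
Proof.
move=> ta tb [pxy [cx ox] [cy oy]]; split=> //.
  apply: thick_les ta _ ox; apply: filterS cx => w.
  by rewrite /les /closer; case: (s); lia.
apply: thick_les tb _ oy; apply: filterS cy => w.
by rewrite /les /closer; case: (t); lia.
Qed.

(** Two points of the cell, the second nearer to both lines, show the sign: such a pair increases
    exactly when [s = t]. *)
Lemma cofinal_entry c e a b s t : vthick c a -> hthick e b ->
  cofinal kap U plot (cut v (vrep (boundary c s))) (cut h (hrep (boundary e t))) s t ->
  M c e = sign_entry (s == t).
Proof.
move=> ta tb cof.
have [x [y b1]] := cof _ _ (thick_on s ta) (thick_on t tb).
have [_ [_ ox] [_ oy]] := b1; have [x' [y' [pxy' [cx' ox'] [cy' oy']]]] := cof _ _ ox oy.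
have ic := beyond_limit_cell ta tb b1.
have ic' : in_limit_cell c e x' y'.
  have [_ tx ty] := ic.
  by apply: (beyond_limit_cell tx ty (s := s) (t := t)).
have [sg Me] := limit_cell_sign ic; have lt := limit_cell_monotone Me ic ic' cx'.
rewrite Me; congr sign_entry; have [<-|ne] := eqVneq (s == sg) t; first by case: (s); case: (sg).
by exfalso; apply: cls_asym cy' _; rewrite (_ : ~~ t = (s == sg)) //; move: ne; case: (s == sg); case: (t).
Qed.

Lemma limit_diagonals (i : 'I_m.+1) (j : 'I_n.+1) : vrep i = i -> hrep j = j ->
  external kap U (cut v i) -> external kap U (cut h j) -> diagonals kap U plot (cut v i) (cut h j).
Proof.
move=> ri rj ei ej s t cof.
have [c [a [ta rc]]] := adjacent_thick v0 vL v_mono s ei.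
have [e [b [tb re]]] := adjacent_thick h0 hL h_mono t ej.
rewrite -ri -rc -rj -re in cof *.
exists a, b; split; [exact: thick_on|exact: thick_on|] => x y x' y' b1 b2 lt.
have Me := cofinal_entry ta tb cof.
have := limit_cell_monotone Me (beyond_limit_cell ta tb b1) (beyond_limit_cell ta tb b2) lt.
by case: (s); case: (t).
Qed.

Definition v_external (i : 'I_m.+1) := vrep i = i /\ external kap U (cut v i).
Definition h_external (j : 'I_n.+1) := hrep j = j /\ external kap U (cut h j).

Lemma crossing_data : exists (sgf : 'I_m.+1 -> 'I_n.+1 -> option bool)
    (xf yf : 'I_m.+1 -> 'I_n.+1 -> bool -> num), forall i j, v_external i -> h_external j ->
  crossing_box kap U plot (cut v i) (cut h j) (sgf i j) (xf i j) (yf i j).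
Proof.
have ex (ij : 'I_m.+1 * 'I_n.+1) : exists r : option bool * (bool -> num) * (bool -> num),
    v_external ij.1 -> h_external ij.2 ->
    crossing_box kap U plot (cut v ij.1) (cut h ij.2) r.1.1 r.1.2 r.2.
  have [[ri ei]|n1] := pselect (v_external ij.1); last by exists (None, (fun=> fun=> 0), (fun=> fun=> 0)).
  have [[rj ej]|n2] := pselect (h_external ij.2); last by exists (None, (fun=> fun=> 0), (fun=> fun=> 0)).
  have [sg [xs [ys cb]]] := crossing_boxP plot_fun (cut_bounded vL v_mono _) ei
    (cut_bounded hL h_mono _) ej (limit_diagonals ri rj ei ej).
  by exists (sg, xs, ys).
have [f fP] := choice ex.
exists (fun i j => (f (i, j)).1.1), (fun i j => (f (i, j)).1.2), (fun i j => (f (i, j)).2).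
by move=> i j; exact: (fP (i, j)).
Qed.

(** * Conditions on all lines at once *)

Local Notation line_index := ('I_m.+1 + 'I_n.+1)%type.

Definition line (r : line_index) : Omega -> nat :=
  match r with inl i => cut v i | inr j => cut h j end.

(** [Q] holds on a product of internal intervals around the lines; this notion is stable under
    finite conjunctions. *)
Definition nearly (Q : K -> (line_index -> nat) -> Prop) := exists lo hi : line_index -> num,
  (forall r, \ae_ U w, lo r (kap w) <= line r w <= hi r (kap w)) /\
  \ae_ U w, forall l, (forall r, lo r (kap w) <= l r <= hi r (kap w)) -> Q (kap w) l.

Lemma line_bounded r : bounded_line kap U (line r).
Proof. by case: r => i; [exact: cut_bounded vL v_mono i|exact: cut_bounded hL h_mono i]. Qed.

Lemma nearlyS (Q R : K -> (line_index -> nat) -> Prop) :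
  (forall k l, Q k l -> R k l) -> nearly Q -> nearly R.
Proof.
move=> QR [lo [hi [h1 h2]]]; exists lo, hi; split=> //.
by apply: filterS h2 => w h3 l /h3; exact: QR.
Qed.

Lemma nearlyI (Q R : K -> (line_index -> nat) -> Prop) :
  nearly Q -> nearly R -> nearly (fun k l => Q k l /\ R k l).
Proof.
move=> [lo [hi [h1 h2]]] [lo' [hi' [h1' h2']]].
exists (fun r k => maxn (lo r k) (lo' r k)), (fun r k => minn (hi r k) (hi' r k)); split.
  by move=> r; apply: filterS2 (h1 r) (h1' r) => w; lia.
apply: filterS2 h2 h2' => w g g' l hl.
by split; [apply: g|apply: g'] => r; have := hl r; lia.
Qed.

Lemma nearly_seq (T : eqType) (s : seq T) (Q : T -> K -> (line_index -> nat) -> Prop) :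
  (forall t, nearly (Q t)) -> nearly (fun k l => forall t, t \in s -> Q t k l).
Proof.
move=> H; elim: s => [|t s IH].
  have [b bP] := choice line_bounded.
  by exists (fun=> fun=> 0), b; split=> //; apply: nearW => w l _ t; rewrite in_nil.
apply: nearlyS (nearlyI (H t) IH) => k l [h1 h2] t'.
by rewrite inE => /orP[/eqP->|/h2].
Qed.

Lemma nearly_all (T : finType) (Q : T -> K -> (line_index -> nat) -> Prop) :
  (forall t, nearly (Q t)) -> nearly (fun k l => forall t, Q t k l).
Proof.
move=> /(nearly_seq (enum T)); apply: nearlyS => k l H t.
by apply: H; rewrite mem_enum.
Qed.

Lemma nearly_line r Q : near_line kap U (line r) Q -> nearly (fun k l => Q k (l r)).
Proof.
move=> [lo [hi [h1 h2]]]; have [b bP] := choice line_bounded.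
exists (fun r' => if r' == r then lo else fun=> 0), (fun r' => if r' == r then hi else b r').
split; first by move=> r'; case: eqP => [->|_] //; exact: bP.
by apply: filterS h2 => w g l /(_ r); rewrite eqxx; exact: g.
Qed.

Lemma nearly_pair i j Q : near_pair kap U (cut v i) (cut h j) Q ->
  nearly (fun k l => Q k (l (inl i)) (l (inr j))).
Proof.
move=> [lo [hi [lo' [hi' [h1 h2 h3]]]]]; have [b bP] := choice line_bounded.
exists (fun r => match r with inl i' => if i' == i then lo else fun=> 0
                            | inr j' => if j' == j then lo' else fun=> 0 end),
  (fun r => match r with inl i' => if i' == i then hi else b r
                       | inr j' => if j' == j then hi' else b r end); split.
  by case=> i' /=; case: eqP => [->|_] //; [exact: (bP (inl i'))|exact: (bP (inr i'))].
apply: filterS h3 => w g l hl; apply: g.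
  by have := hl (inl i); rewrite eqxx.
by have := hl (inr j); rewrite eqxx.
Qed.

Section Curves.
Variables (sgf : 'I_m.+1 -> 'I_n.+1 -> option bool).
Variables (xf yf : 'I_m.+1 -> 'I_n.+1 -> bool -> num).
Hypothesis boxes : forall i j, v_external i -> h_external j ->
  crossing_box kap U plot (cut v i) (cut h j) (sgf i j) (xf i j) (yf i j).

Definition curves k (l : line_index -> nat) := forall i j, v_external i -> h_external j ->
  on_curve plot (sgf i j) (xf i j) (yf i j) k (l (inl i)) (l (inr j)).

Section Cell.
Variables (c : 'I_m) (e : 'I_n) (a b : num).
Hypotheses (ta : vthick c a) (tb : hthick e b).
Let vl s := vrep (boundary c s).
Let hl t := hrep (boundary e t).

Lemma reg_limit_cell x0 y0 s t x y : vthick c x0 -> hthick e y0 ->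
  reg kap U plot (cut v (vl s)) (cut h (hl t)) s t x0 y0 x y -> in_limit_cell c e x y.
Proof.
by move=> t1 t2 [pxy lx ox ly oy]; split=> //; [exact: thick_les t1 lx ox|exact: thick_les t2 ly oy].
Qed.

Lemma external_pair s t : external kap U (cut v (vl s)) /\ external kap U (cut h (hl t)) ->
  v_external (vl s) /\ h_external (hl t).
Proof.
case=> ev eh; split; split=> //.
  exact: rep_idem.
exact: rep_idem.
Qed.

Lemma nearly_monotone_corner s t sg x0 y0 : vthick c x0 -> hthick e y0 -> M c e = sign_entry sg ->
  t = (s == sg) ->
  nearly (fun k l => curves k l -> monotone_reg plot s t x0 y0 k (l (inl (vl s))) (l (inr (hl t)))).
Proof.
move=> t1 t2 Me et.
have D x y x' y' : reg kap U plot (cut v (vl s)) (cut h (hl t)) s t x0 y0 x y ->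
    reg kap U plot (cut v (vl s)) (cut h (hl t)) s t x0 y0 x' y' -> cls s x x' -> cls t y y'.
  move=> /(reg_limit_cell t1 t2) r1 /(reg_limit_cell t1 t2) r2 lt; rewrite et.
  exact: limit_cell_monotone Me r1 r2 lt.
have b1 := cut_bounded vL v_mono (vl s); have b2 := cut_bounded hL h_mono (hl t).
have o1 := thick_on s t1; have o2 := thick_on t t2.
have [ex|nex] := pselect (external kap U (cut v (vl s)) /\ external kap U (cut h (hl t))).
  have [ev eh] := external_pair ex.
  apply: nearlyS (nearly_pair (monotone_corner_curve plot_fun b1 b2 o1 o2 (boxes ev eh) D)).
  by move=> k l H cv; apply: H; exact: cv.
apply: nearlyS (nearly_pair (monotone_corner_internal b1 b2 o1 o2 nex D)).
by move=> k l H cv.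
Qed.

Lemma nearly_vacant_corner s t x0 y0 (bad : K -> nat -> nat -> Prop) : vthick c x0 -> hthick e y0 ->
  (forall x y, cls s x0 x -> \ae_ U w, bad (kap w) (x (kap w)) (y (kap w))) ->
  (forall x y, reg kap U plot (cut v (vl s)) (cut h (hl t)) s t x0 y0 x y ->
     (\ae_ U w, bad (kap w) (x (kap w)) (y (kap w))) -> False) ->
  nearly (fun k l => curves k l -> vacant_reg plot s t x0 y0 bad k (l (inl (vl s))) (l (inr (hl t)))).
Proof.
move=> t1 t2 bb H.
have b1 := cut_bounded vL v_mono (vl s); have b2 := cut_bounded hL h_mono (hl t).
have o1 := thick_on s t1; have o2 := thick_on t t2.
have bb' x y : beyond kap U plot (cut v (vl s)) (cut h (hl t)) s t x0 y0 x y ->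
  \ae_ U w, bad (kap w) (x (kap w)) (y (kap w)) by case=> _ [cx _] _; exact: bb.
have [ex|nex] := pselect (external kap U (cut v (vl s)) /\ external kap U (cut h (hl t))).
  have [ev eh] := external_pair ex.
  apply: nearlyS (nearly_pair (vacant_corner_curve b1 b2 o1 o2 (boxes ev eh) bb' H)).
  by move=> k l H' cv; apply: H'; exact: cv.
apply: nearlyS (nearly_pair (vacant_corner_internal b1 b2 o1 o2 nex H)).
by move=> k l H' cv.
Qed.

Definition config_cell k (l : line_index -> nat) :=
  in_cell (L k) (p k) (l (inl (vl false))) (l (inl (vl true))) (l (inr (hl false))) (l (inr (hl true))).

Lemma config_cell_reg k l x x0 y0 t : config_cell k l x ->
  les t y0 (nth 0 (p k) x) ->
  in_reg plot (x0 <= x) t (fun=> x0) (fun=> y0) k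
    (l (inl (vl (x0 <= x)))) (l (inr (hl t))) x (nth 0 (p k) x).
Proof.
move=> /andP[/andP[xL /andP[x1 x2]] /andP[y1 y2]] lt; split=> //.
- by rewrite /les /closer; case: (leqP x0 x) => //; lia.
- by rewrite /side; case: (leqP x0 x).
- by rewrite /side; case: (t).
Qed.

(** An internal position [(a, b)] inside the cell divides it into four regions with one corner each,
    treated separately. *)
Lemma nearly_empty_cell : (forall x y, in_limit_cell c e x y -> False) ->
  nearly (fun k l => curves k l -> cell_ok (M c e) (config_cell k l) (p k)).
Proof.
move=> emp.
have H (st : bool * bool) : nearly (fun k l => curves k l -> vacant_reg plot st.1 st.2 a b
    (fun _ _ _ => True) k (l (inl (vl st.1))) (l (inr (hl st.2)))).
  apply: nearly_vacant_corner => // [x y _|x y /(reg_limit_cell ta tb) /emp //].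
  exact: filterT.
apply: nearlyS (nearly_all H) => k l {}H cv.
suff no x : ~~ config_cell k l x.
  by split=> // _ x y /(negP (no x)).
apply/negP => ic.
have [t le] : exists t, les t (b k) (nth 0 (p k) x).
  by exists (b k <= nth 0 (p k) x); rewrite /les /closer; case: (leqP (b k)) => //; lia.
have := config_cell_reg (a k) ic le => r.
by apply: (H (a k <= x, t) cv x (nth 0 (p k) x)) => //; case: r.
Qed.

(** With a point [z] of the cell as anchor, the other points lie in the two regions allowed by the
    sign. Each of these is monotone, and points of different regions are compared through [z]. *)
Lemma nearly_nonempty_cell zx zy : in_limit_cell c e zx zy ->
  nearly (fun k l => curves k l -> cell_ok (M c e) (config_cell k l) (p k)).
Proof.
move=> iz; have [pz t1 t2] := iz; have [sg Me] := limit_cell_sign iz.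
have H1 s : nearly (fun k l => curves k l -> monotone_reg plot s (s == sg) zx zy k
    (l (inl (vl s))) (l (inr (hl (s == sg))))).
  exact: nearly_monotone_corner t1 t2 Me _.
(* The anchor belongs to all four regions, so it has to be exempted. *)
have H2 s : nearly (fun k l => curves k l -> vacant_reg plot s (~~ (s == sg)) zx zy
    (fun k x _ => x <> zx k) k (l (inl (vl s))) (l (inr (hl (~~ (s == sg)))))).
  apply: nearly_vacant_corner => // [x y|x y r nx].
    by apply: filterS => w; rewrite /closer; case: (s); lia.
  have cx : cls s zx x.
    case: r => _ lx _ _ _; apply: filterS2 lx nx => w.
    by rewrite /les /closer; case: (s); lia.
  have := limit_cell_monotone Me iz (reg_limit_cell t1 t2 r) cx.
  case: r => _ _ _ ly _ cy; apply: (@ae_False _ U); apply: filterS2 ly cy => w.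
  by rewrite /les /closer; case: (s == sg) => /=; lia.
have [lo [hi [n1 n2]]] := nearlyI (nearly_all H1) (nearly_all H2).
exists lo, hi; split=> //; apply: filterS2 pz n2 => w; set k := kap w => -[zL zE] n3 l lhl cv.
have [{}H1 {}H2] := n3 _ lhl.
pose y x := nth 0 (p k) x.
have yz x : x = zx k -> y x = zy k by move=> ->; exact: zE.
have past_z x : config_cell k l x -> x != zx k -> closer (zx k <= x) (zx k) x /\
    closer ((zx k <= x) == sg) (zy k) (y x).
  move=> ic nx; split; first by move: nx; rewrite /closer; case: (leqP (zx k) x) => //; lia.
  apply/negbNE/negP => nc.
  have le : les (~~ ((zx k <= x) == sg)) (zy k) (y x).
    by move: nc; rewrite /les /closer; case: (_ == sg) => //=; lia.
  have := config_cell_reg (zx k) ic le => r.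
  by apply: (H2 (zx k <= x) cv x (y x) r); exact/eqP.
have reg_z x : config_cell k l x -> x != zx k -> in_reg plot (zx k <= x) ((zx k <= x) == sg) zx zy k
    (l (inl (vl (zx k <= x)))) (l (inr (hl ((zx k <= x) == sg)))) x (y x).
  move=> ic nx; have [_ cy] := past_z x ic nx.
  have le : les ((zx k <= x) == sg) (zy k) (y x).
    by move: cy; rewrite /les /closer; case: (_ == sg) => //=; lia.
  by have [] := config_cell_reg (zx k) ic le.
have mono x x' : config_cell k l x -> config_cell k l x' -> x < x' -> closer sg (y x) (y x').
  move=> ic ic' xx'.
  have [xz|nx] := eqVneq x (zx k).
    have nx' : x' != zx k by rewrite -xz neq_ltn xx' orbT.
    by have [_] := past_z x' ic' nx'; rewrite -(yz x xz) -xz (ltnW xx'); case: (sg).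
  have [xz'|nx'] := eqVneq x' (zx k).
    by have [_] := past_z x ic nx; rewrite -(yz x' xz') -xz' leqNgt xx'; case: (sg).
  have [lx|lx] := leqP (zx k) x; have [lx'|lx'] := leqP (zx k) x'.
  - have := reg_z x ic nx; have := reg_z x' ic' nx'; rewrite lx lx' => r' r.
    by have := H1 true cv _ _ _ _ r r' xx'; case: (sg).
  - by have := leq_ltn_trans lx (ltn_trans xx' lx'); rewrite ltnn.
  - have [_] := past_z x ic nx; have [_] := past_z x' ic' nx'.
    rewrite lx' leqNgt lx /closer; case: (sg) => /= c1 c2; last exact: ltn_trans c1 c2.
    exact: ltn_trans c2 c1.
  - have := reg_z x ic nx; have := reg_z x' ic' nx'; rewrite (leqNgt (zx k) x) (leqNgt (zx k) x') lx lx' => r' r.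
    by have := H1 false cv _ _ _ _ r' r xx'; case: (sg).
split; first by rewrite Me; case: (sg).
  by rewrite Me => es x x' ic ic' lt; have := mono x x' ic ic' lt; move: es; case: (sg).
by rewrite Me => es x x' ic ic' lt; have := mono x x' ic ic' lt; move: es; case: (sg).
Qed.

End Cell.

Lemma nearly_cell c e :
  nearly (fun k l => curves k l -> cell_ok (M c e) (config_cell c e k l) (p k)).
Proof.
have empty_ok k l : (forall x, ~~ config_cell c e k l x) -> cell_ok (M c e) (config_cell c e k l) (p k).
  by move=> no; split=> // _ x y /(negP (no x)).
have thin_ok : (forall k l x, ~~ config_cell c e k l x) ->
    nearly (fun k l => curves k l -> cell_ok (M c e) (config_cell c e k l) (p k)).
  move=> H; apply: nearlyS (nearly_all (T := void) (Q := fun _ _ _ => True) _) => [k l _ _|[]].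
  exact: empty_ok.
have [[a ta]|/(thin_rep v_mono) r1] := pselect (exists a, vthick c a); last first.
  apply: thin_ok => k l x; apply/negP => /andP[/andP[_ /andP[u1 u2]] _].
  by have := leq_ltn_trans u1 u2; rewrite r1 ltnn.
have [[b tb]|/(thin_rep h_mono) r2] := pselect (exists b, hthick e b); last first.
  apply: thin_ok => k l x; apply/negP => /andP[_ /andP[u1 u2]].
  by have := leq_ltn_trans u1 u2; rewrite r2 ltnn.
have [[x [y ic]]|n1] := pselect (exists x y, in_limit_cell c e x y).
  exact: nearly_nonempty_cell ic.
by apply: (nearly_empty_cell ta tb) => x y ic; apply: n1; exists x, y.
Qed.

Definition config_v (l : line_index -> nat) i := l (inl (vrep (inord i))).
Definition config_h (l : line_index -> nat) j := l (inr (hrep (inord j))).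

Lemma nearly_gridding : nearly (fun k l => curves k l -> gridding M (p k) (config_v l) (config_h l)).
Proof.
have A0 := nearly_line (r := inl _) (near_line0 kap m v0).
have A1 := nearly_line (r := inl _) (near_line_max vL).
have B0 := nearly_line (r := inr _) (near_line0 kap n h0).
have B1 := nearly_line (r := inr _) (near_line_max hL).
have A2 : nearly (fun k l => forall c : 'I_m,
    l (inl (vrep (boundary c false))) <= l (inl (vrep (boundary c true)))).
  apply: nearly_all => c.
  have [[a ta]|/(thin_rep v_mono) r1] := pselect (exists a, vthick c a).
    apply: nearlyS (nearlyI (nearly_line (r := inl _) (thick_near vL v_mono false ta))
      (nearly_line (r := inl _) (thick_near vL v_mono true ta))) => k l [].
    by rewrite /side => s1 /ltnW; exact: leq_trans.
  by apply: nearlyS A0 => k l _; rewrite r1.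
have B2 : nearly (fun k l => forall c : 'I_n,
    l (inr (hrep (boundary c false))) <= l (inr (hrep (boundary c true)))).
  apply: nearly_all => c.
  have [[a ta]|/(thin_rep h_mono) r1] := pselect (exists a, hthick c a).
    apply: nearlyS (nearlyI (nearly_line (r := inr _) (thick_near hL h_mono false ta))
      (nearly_line (r := inr _) (thick_near hL h_mono true ta))) => k l [].
    by rewrite /side => s1 /ltnW; exact: leq_trans.
  by apply: nearlyS B0 => k l _; rewrite r1.
have C := nearly_all (fun ce : 'I_m * 'I_n => nearly_cell ce.1 ce.2).
apply: nearlyS (nearlyI (nearlyI (nearlyI A0 A1) A2) (nearlyI (nearlyI (nearlyI B0 B1) B2) C)).
move=> k l [[[a0 a1] a2] [[[b0 b1] b2] cs]] cv.
have bf N (c : 'I_N) : boundary c false = inord c by rewrite /boundary addn0.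
have bt N (c : 'I_N) : boundary c true = inord c.+1 by rewrite /boundary addn1.
have i0 N : inord 0 = ord0 :> 'I_N.+1 by apply: val_inj; rewrite /= inordK.
have iN N : inord N = ord_max :> 'I_N.+1 by apply: val_inj; rewrite /= inordK.
split; [split|split; [split|]].
- by rewrite /config_v i0.
- by rewrite /config_v iN.
- by move=> j jm; have := a2 (Ordinal jm); rewrite bf bt.
- by rewrite /config_h i0.
- by rewrite /config_h iN.
- by move=> j jn; have := b2 (Ordinal jn); rewrite bf bt.
by move=> i j; have := cs (i, j) cv; rewrite /= /config_cell !bf !bt.
Qed.

(** * Placing the lines along a forest of crossings *)

Definition line_external (r : line_index) :=
  match r with inl i => v_external i | inr j => h_external j end.

Definition crossing (r r' : line_index) :=
  match r, r' with
  | inl i, inr j => sgf i j != None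
  | inr j, inl i => sgf i j != None
  | _, _ => false
  end.

Definition curve_between r r' k a b :=
  match r, r' with
  | inl i, inr j => on_curve plot (sgf i j) (xf i j) (yf i j) k a b
  | inr j, inl i => on_curve plot (sgf i j) (xf i j) (yf i j) k b a
  | _, _ => True
  end.

Lemma curve_betweenC r r' k a b : curve_between r r' k a b -> curve_between r' r k b a.
Proof. by case: r; case: r'. Qed.

Lemma not_crossing_curve r r' k a b : ~~ crossing r r' -> curve_between r r' k a b.
Proof.
by case: r => i; case: r' => j //=; case: (sgf _ _) => //= _ x y.
Qed.

Lemma leaf_step r r' lo hi : line_external r -> line_external r' -> crossing r r' ->
  (\ae_ U w, lo (kap w) <= line r w <= hi (kap w)) ->
  exists lo' hi', (\ae_ U w, lo' (kap w) <= line r' w <= hi' (kap w)) /\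
    \ae_ U w, forall b, lo' (kap w) <= b <= hi' (kap w) ->
      exists a, lo (kap w) <= a <= hi (kap w) /\ curve_between r r' (kap w) a b.
Proof.
rewrite /curve_between; case: r => i; case: r' => j //= ei ej.
  have := boxes ei ej; case: (sgf i j) => // sg cb _ lh.
  exact: (curve_step plot_fun ei.2 cb lh).
have := boxes ej ei; case: (sgf j i) => // sg cb _ lh.
have cb' := crossing_box_tr plot_fun cb.
have [|lo' [hi' [h1 h2]]] := curve_step _ ei.2 cb' lh.
  by move=> k x y y'; exact: plot_inj.
exists lo', hi'; split=> //; apply: filterS h2 => w h2 b /h2[a [ha ca]].
by exists a; split=> //; exact: on_curve_tr.
Qed.

(** A leaf is placed last: the interval of its only neighbour is first shrunk to the lines that can
    be followed back into the interval of the leaf. Therefore [lo] and [hi] vary in the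
    induction. *)
Lemma leaf_induction (A : {set line_index}) :
  (forall r, r \in A -> line_external r) ->
  (forall B : {set line_index}, B \subset A -> B != set0 -> exists2 r, r \in B &
     forall r1 r2, r1 \in B -> r2 \in B -> crossing r r1 -> crossing r r2 -> r1 = r2) ->
  forall lo hi : line_index -> num, (forall r, \ae_ U w, lo r (kap w) <= line r w <= hi r (kap w)) ->
  exists l : line_index -> num, (forall r, r \in A -> \ae_ U w, lo r (kap w) <= l r (kap w) <= hi r (kap w)) /\
    forall r r', r \in A -> r' \in A -> \ae_ U w, curve_between r r' (kap w) (l r (kap w)) (l r' (kap w)).
Proof.
move: {2}#|A| (leqnn #|A|) => N; elim: N A => [|N IH] A.
  rewrite leqn0 cards_eq0 => /eqP-> _ _ lo hi _.
  by exists (fun=> fun=> 0); split=> [r|r r']; rewrite in_set0.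
move=> cA extA leafA lo hi lh; have [A0|nA] := eqVneq A set0.
  by exists (fun=> fun=> 0); split=> [r|r r']; rewrite A0 in_set0.
have [r0 r0A leaf] := leafA A (subxx _) nA.
have sub : A :\ r0 \subset A by exact: subD1set.
have cA' : #|A :\ r0| <= N by move: cA; rewrite (cardsD1 r0) r0A add1n ltnS.
have {}IH := IH (A :\ r0) cA' (fun r rA => extA r (subsetP sub r rA))
  (fun B BA => leafA B (subset_trans BA sub)).
suff [l' [W [lW [lo0 hi0] cv]]] : exists (l' : line_index -> num) (W : num),
    [/\ forall r, r \in A :\ r0 -> \ae_ U w, lo r (kap w) <= l' r (kap w) <= hi r (kap w),
        (\ae_ U w, lo r0 (kap w) <= W (kap w) <= hi r0 (kap w)) /\
        (forall r r', r \in A :\ r0 -> r' \in A :\ r0 ->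
          \ae_ U w, curve_between r r' (kap w) (l' r (kap w)) (l' r' (kap w))) &
        forall r, r \in A :\ r0 -> \ae_ U w, curve_between r0 r (kap w) (W (kap w)) (l' r (kap w))].
  exists (fun r => if r == r0 then W else l' r); split=> [r rA|r r' rA rA'].
    by case: eqP => [->//|/eqP ne]; apply: lW; rewrite !inE ne.
  have [e|ne] := eqVneq r r0; have [e'|ne'] := eqVneq r' r0.
  - by apply: nearW => w; rewrite e e'; case: (r0).
  - by rewrite e; apply: cv; rewrite !inE ne'.
  - have rin : r \in A :\ r0 by rewrite !inE ne.
    by rewrite e'; apply: filterS (cv r rin) => w; exact: curve_betweenC.
  - by apply: hi0; rewrite !inE ?ne ?ne'.
have [/existsP[r1 /andP[r1A c1]]|/existsPn none] := boolP [exists r, (r \in A :\ r0) && crossing r0 r].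
  have r1A' := subsetP sub _ r1A.
  have [lo' [hi' [lh' step]]] := leaf_step (extA _ r0A) (extA _ r1A') c1 (lh r0).
  pose lo2 r k := if r == r1 then maxn (lo r k) (lo' k) else lo r k.
  pose hi2 r k := if r == r1 then minn (hi r k) (hi' k) else hi r k.
  have [r|l' [l1 l2]] := IH lo2 hi2.
    rewrite /lo2 /hi2; have [->|_] := eqVneq r r1; last exact: lh.
    by apply: filterS2 (lh r1) lh' => w; lia.
  have ex : \ae_ U w, exists a, lo r0 (kap w) <= a <= hi r0 (kap w) /\
      curve_between r0 r1 (kap w) a (l' r1 (kap w)).
    apply: filterS2 step (l1 r1 r1A) => w st; rewrite /lo2 /hi2 eqxx => hh.
    by apply: st; lia.
  have [W WP] := choose_internal (A := fun k a => lo r0 k <= a <= hi r0 k /\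
      curve_between r0 r1 k a (l' r1 k)) 0 ex.
  exists l', W; split.
  - move=> r rA; apply: filterS (l1 r rA) => w; rewrite /lo2 /hi2; case: eqP => // _; lia.
  - by split=> //; apply: filterS WP => w [].
  - move=> r rA; have [cr|/not_crossing_curve nc] := boolP (crossing r0 r); last exact: nearW.
    have -> : r = r1 by apply: leaf => //; exact: (subsetP sub).
    by apply: filterS WP => w [].
have [l' [l1 l2]] := IH lo hi lh.
exists l', (lo r0); split=> //.
  by split=> //; apply: filterS (lh r0) => w; lia.
move=> r rA; apply: nearW => w; apply: not_crossing_curve.
by have := none r; rewrite rA.
Qed.

Definition external_lines : {set line_index} := [set r | `[< line_external r >]].

Lemma forest_gridding :
  (forall B : {set line_index}, B \subset external_lines -> B != set0 -> exists2 r, r \in B &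
     forall r1 r2, r1 \in B -> r2 \in B -> crossing r r1 -> crossing r r2 -> r1 = r2) ->
  \ae_ U w, Grid M (p (kap w)).
Proof.
move=> forest; have [lo [hi [lh gr]]] := nearly_gridding.
have ext r : r \in external_lines -> line_external r by rewrite inE => /asboolP.
have [l [ll cv]] := leaf_induction ext forest lh.
(* Lines outside [external_lines] occur in no curve condition; any value from their interval will
   do. *)
pose l' r k := if r \in external_lines then l r k else lo r k.
have ll' : \ae_ U w, forall r, lo r (kap w) <= l' r (kap w) <= hi r (kap w).
  apply: ae_forall => r; rewrite /l'; have [rA|_] := boolP (r \in external_lines); first exact: ll.
  by apply: filterS (lh r) => w; lia.
have cv' : \ae_ U w, forall rr : line_index * line_index,
    rr.1 \in external_lines -> rr.2 \in external_lines ->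
    curve_between rr.1 rr.2 (kap w) (l rr.1 (kap w)) (l rr.2 (kap w)).
  apply: ae_forall.
  move=> [r r'] /=; case: (boolP (r \in external_lines)) => [rA|_]; last exact: nearW.
  case: (boolP (r' \in external_lines)) => [rA'|_]; last exact: nearW.
  by apply: filterS (cv r r' rA rA').
apply: filterS3 gr ll' cv' => w g lw cw; split=> //.
exists (config_v (l' ^~ (kap w))), (config_h (l' ^~ (kap w))).
apply: g => // i j ei ej; have iE : inl i \in external_lines by rewrite inE; exact/asboolP.
have jE : inr j \in external_lines by rewrite inE; exact/asboolP.
by have := cw (inl i, inr j) iE jE; rewrite /l' /= iE jE.
Qed.

(** * The double cover of the crossing graph over the row-column graph *)

Lemma rc_adj_sym : symmetric (rc_adj M).
Proof. by case=> i; case=> j. Qed.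

Lemma rc_adj_irr : irreflexive (rc_adj M).
Proof. by case. Qed.

Local Notation sided_line := (line_index * bool)%type.
Local Notation rc_vertex := ('I_m + 'I_n)%type.

(* The edges of a double cover of the crossing graph: a side of a vertical line is linked to
   the side of a horizontal line with which it bounds a quadrant containing the curve. *)
Definition link (a b : sided_line) := match a, b with
  | (inl i, s), (inr j, t) => sgf i j == Some (s == t)
  | (inr j, t), (inl i, s) => sgf i j == Some (s == t)
  | _, _ => false
  end.

(** The projection of the double cover, as a relation: the thick column or row next to the line on
    the given side. *)
Definition touches (a : sided_line) (u : rc_vertex) : Prop := match a.1, u with
  | inl i, inl c => (exists x, vthick c x) /\ vrep (boundary c a.2) = i
  | inr j, inr e => (exists y, hthick e y) /\ hrep (boundary e a.2) = j
  | _, _ => False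
  end.

Definition has_sign (u u' : rc_vertex) (sg : bool) : Prop := match u, u' with
  | inl c, inr e => M c e = sign_entry sg
  | inr e, inl c => M c e = sign_entry sg
  | _, _ => False
  end.

Lemma linkC a b : link a b = link b a.
Proof. by case: a => [[i|i] s]; case: b => [[j|j] t]. Qed.

Lemma crossing_link r r' s : crossing r r' -> exists t, link (r, s) (r', t).
Proof.
case: r => i; case: r' => j //=; case: (sgf _ _) => // sg _; exists (s == sg); apply/eqP; congr Some;
  by case: s; case: sg.
Qed.

Lemma touches_ex a : line_external a.1 -> exists u, touches a u.
Proof.
case: a => [[i|j] s] [/= r e].
  by have [c [x [tx rc]]] := adjacent_thick v0 vL v_mono s e; exists (inl c); split; [exists x|rewrite rc r].
by have [c [x [tx rc]]] := adjacent_thick h0 hL h_mono s e; exists (inr c); split; [exists x|rewrite rc r].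
Qed.

Lemma touches_inj r r' s u : touches (r, s) u -> touches (r', s) u -> r = r'.
Proof. by case: r => i; case: r' => j; case: u => c //= [_ <-] [_ <-]. Qed.

Lemma link_sign a b u u' : line_external a.1 -> line_external b.1 -> link a b ->
  touches a u -> touches b u' -> has_sign u u' (a.2 == b.2).
Proof.
have main i j s t c e : v_external i -> h_external j -> sgf i j = Some (s == t) ->
    touches (inl i, s) (inl c) -> touches (inr j, t) (inr e) -> M c e = sign_entry (s == t).
  move=> ei ej sE [[x tx] /= rc] [[y ty] /= re]; apply: (cofinal_entry tx ty); rewrite rc re.
  by have [_ _ /(_ s t)] := boxes ei ej; rewrite sE eqxx => -[].
case: a => [[i|j] s]; case: b => [[i'|j'] t] //=; case: u => c //; case: u' => e // ea eb /eqP lk t1 t2.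
  exact: main ea eb lk t1 t2.
by rewrite eq_sym; exact: main eb ea lk t2 t1.
Qed.

Lemma has_sign_adj u u' sg : has_sign u u' sg -> rc_adj M u u'.
Proof. by case: u => c; case: u' => e //= ->; case: sg. Qed.

Lemma has_sign_inj u u' sg sg' : has_sign u u' sg -> has_sign u u' sg' -> sg = sg'.
Proof. by case: u => c; case: u' => e //= -> /sign_entry_inj. Qed.

(** The marked side of one line goes to the marked side of the other, and the unmarked to the
    unmarked; from [(r, false)] to [(r, true)] this exchanges the sides of [r]. *)
Definition side_preserving (a b : sided_line) := exists f : K -> nat -> nat, forall u x,
  on (u == a.2) x (line a.1) -> on (u == b.2) (fun k => f k (x k)) (line b.1).

Lemma link_transfer a b : line_external a.1 -> line_external b.1 -> link a b -> side_preserving a b.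
Proof.
have bb (u s t : bool) : ((u == s) == (s == t)) = (u == t) by case: u; case: s; case: t.
case: a => [[i|j] s]; case: b => [[i'|j'] t] //= ea eb /eqP lk.
  have := boxes ea eb; rewrite lk => cb.
  have [f fP] := transfer eb.2 (fun k x y pl => (plot_bound pl).2) cb.
  by exists f => u x /fP; rewrite bb.
have := boxes eb ea; rewrite lk => /(crossing_box_tr plot_fun) cb.
have [f fP] := transfer eb.2 (fun k y x pl => (plot_bound pl).1) cb.
by exists f => u x /fP; rewrite [X in _ == X]eq_sym bb.
Qed.

Lemma side_preserving_trans a b c : side_preserving a b -> side_preserving b c -> side_preserving a c.
Proof. by move=> [f fP] [g gP]; exists (fun k x => g k (f k x)) => u x /fP /gP. Qed.

(* If every line of [B] crosses two others of [B], the edges of the double cover map to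
   subgraphs of minimum degree 2 of the row-column graph.  By [unique_cycle_cover] the
   components of both sides of the leftmost line map onto the unique cycle; but only the left
   side of that line lies over the column on its left, so both sides are in one component. *)
Lemma no_crossing_core (B : {set line_index}) : unicyclic M -> B \subset external_lines -> B != set0 ->
  (forall r, r \in B -> exists r1 r2, [/\ r1 \in B, r2 \in B, r1 != r2, crossing r r1 & crossing r r2]) ->
  False.
Proof.
move=> [C [cycC uniqC]] Bext nB deg2.
have ext r : r \in B -> line_external r.
  by move/(subsetP Bext); rewrite inE => /asboolP.
pose dn (a b : sided_line) := [&& link a b, a.1 \in B & b.1 \in B].
have dnC : symmetric dn by move=> a b; rewrite /dn linkC; case: (a.1 \in B); case: (b.1 \in B).
have connB a0 a : a0.1 \in B -> connect dn a0 a -> a.1 \in B.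
  move=> a0B /connectP[q pq ->]; elim: q a0 a0B pq => //= b q IH a0 _ /andP[/and3P[_ _ bB]].
  exact: IH.
pose H a0 : {set rc_vertex} := [set u | `[< exists a, connect dn a0 a /\ touches a u >]].
have main a0 u : a0.1 \in B -> u \in H a0 -> u \in cover C /\ cover C \subset H a0.
  move=> a0B; pose f u u' := `[< exists a b, [/\ dn a b, connect dn a0 a, connect dn a0 b, touches a u & touches b u'] >].
  apply: (unique_cycle_cover (e := rc_adj M) (f := f) rc_adj_sym rc_adj_irr cycC uniqC).
  - move=> w w' /asboolP[a [b [/and3P[lk aB bB] _ _ t1 t2]]].
    exact: has_sign_adj (link_sign (ext _ aB) (ext _ bB) lk t1 t2).
  - by move=> w w'; apply/asboolP/asboolP => -[a [b [d1 c1 c2 t1 t2]]]; exists b, a; rewrite dnC.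
  move=> {}u; rewrite inE => /asboolP[a [ca ta]]; have aB := connB _ _ a0B ca.
  have [r1 [r2 [r1B r2B ne c1 c2]]] := deg2 _ aB.
  have [t1 l1] := crossing_link a.2 c1; have [t2 l2] := crossing_link a.2 c2.
  rewrite -surjective_pairing in l1 l2.
  have [u1 p1] := touches_ex (a := (r1, t1)) (ext _ r1B).
  have [u2 p2] := touches_ex (a := (r2, t2)) (ext _ r2B).
  have d1 : dn a (r1, t1) by rewrite /dn l1 aB.
  have d2 : dn a (r2, t2) by rewrite /dn l2 aB.
  have k1 := connect_trans ca (connect1 d1); have k2 := connect_trans ca (connect1 d2).
  exists u1, u2; split; first last.
  - by apply/asboolP; exists a, (r2, t2).
  - by apply/asboolP; exists a, (r1, t1).
  - by rewrite inE; apply/asboolP; exists (r2, t2).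
  - by rewrite inE; apply/asboolP; exists (r1, t1).
  (* One common vertex would give one entry of [M], hence one sign, hence equal sides [t1 = t2],
     hence the same line. *)
  apply: contra_neq ne => eu; rewrite -eu in p2.
  have := has_sign_inj (link_sign (b := (r1, t1)) (ext _ aB) (ext _ r1B) l1 ta p1)
    (link_sign (b := (r2, t2)) (ext _ aB) (ext _ r2B) l2 ta p2).
  move=> /= et; have {}et : t1 = t2 by move: et; case: (a.2); case: (t1); case: (t2).
  by rewrite et in p1; exact: touches_inj p1 p2.
have [i1 i1B] : exists i, inl i \in B.
  have /set0Pn[[i|j] rB] := nB; first by exists i.
  have [r1 [r2 [r1B _ _ c1 _]]] := deg2 _ rB.
  by case: r1 r1B c1 => [i|j'] //= iB _; exists i.
pose i0 := [arg min_(i < i1 | inl i \in B) i].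
have [i0B i0min] : inl i0 \in B /\ forall i, inl i \in B -> i0 <= i.
  by rewrite /i0; case: arg_minnP.
pose a0 : sided_line := (inl i0, true); pose a1 : sided_line := (inl i0, false).
have [u t0] := touches_ex (a := a0) (ext _ i0B); have [u' t1] := touches_ex (a := a1) (ext _ i0B).
have inH a w : touches a w -> w \in H a.
  by move=> ta; rewrite inE; apply/asboolP; exists a; split; first exact: connect0.
have [uC _] := main a0 u i0B (inH _ _ t0); have [_ /subsetP/(_ u uC)] := main a1 u' i0B (inH _ _ t1).
rewrite inE => /asboolP[[r s] [ca ta]]; have rB := connB a1 (r, s) i0B ca.
(* [u] is the column just left of [i0]. A line touching it from the opposite side would have a
   smaller index than [i0], so the sided line found over [u] is [a0] itself. *)
have {}ca : connect dn a1 a0.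
  case: u r t0 ta rB ca {uC inH} => [c|e] [i|j] //= [[x tx] r0] [_ ri] rB.
  rewrite /= in r0 ri rB; case: s ri => ri; first by rewrite /a0 -r0 ri.
  have := i0min _ rB; rewrite -ri -r0 (rep_true v_mono tx).
  by move=> /leq_trans /(_ (rep_false _ _ _ _)); rewrite ltnn.
have sp a b : a.1 \in B -> connect dn a b -> side_preserving a b.
  move=> aB /connectP[q pq ->] {b}; elim: q a aB pq => [|b q IH] a aB /=.
    by move=> _; exists (fun k x => x).
  move=> /andP[/and3P[lk _ bB] pq]; apply: side_preserving_trans (IH b bB pq).
  exact: link_transfer (ext _ aB) (ext _ bB) lk.
have [f fP] := sp a1 a0 i0B ca.
apply: (twisted_not_external (line_bounded (inl i0)) (ext _ i0B).2 (f := f)) => s' x os.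
by have := fP (~~ s') x; rewrite /= !eqbF_neg eqb_id negbK; apply.
Qed.

Lemma unicyclic_gridding : unicyclic M -> \ae_ U w, Grid M (p (kap w)).
Proof.
move=> uM; apply: forest_gridding => B Bext nB; apply: contrapT => no.
apply: (no_crossing_core uM Bext nB) => r rB; apply: contrapT => no2; apply: no.
exists r => // r1 r2 r1B r2B c1 c2; apply: contrapT => /eqP ne; apply: no2.
by exists r1, r2.
Qed.

End Curves.

Theorem limit_gridding : unicyclic M -> \ae_ U w, Grid M (p (kap w)).
Proof.
move=> uM; have [sgf [xf [yf boxes]]] := crossing_data.
exact: unicyclic_gridding boxes uM.
Qed.
End Generic.


(** * Deleting a point, and pulling griddings back *)

Definition unshift d x := if d < x then x.-1 else x.

Lemma unshift_lt d x y : x != d -> y != d -> (unshift d x < unshift d y) = (x < y).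
Proof. by rewrite /unshift; case: (ltnP d x); case: (ltnP d y); lia. Qed.

Section Deletion.
Variables (s : seq nat) (d : nat).
Hypotheses (s_perm : is_perm s) (ds : d < size s).
Let e := nth 0 s d.
Let u := take d s ++ drop d.+1 s.

Definition delete_point := [seq unshift e y | y <- u].

Let size_u : size u = (size s).-1.
Proof. by rewrite size_cat size_take size_drop ds; lia. Qed.

Let s_cat : s = take d s ++ e :: drop d.+1 s.
Proof. by rewrite -drop_nth // cat_take_drop. Qed.

Let u_subseq : subseq u s.
Proof.
have := cat_subseq (subseq_refl (take d s)) (subseq_cons (drop d.+1 s) e).
by rewrite -s_cat.
Qed.

Let u_uniq : uniq u.
Proof. by apply: subseq_uniq u_subseq _; rewrite (perm_uniq s_perm) iota_uniq. Qed.

Let e_notin_u : e \notin u.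
Proof.
have : uniq s by rewrite (perm_uniq s_perm) iota_uniq.
rewrite {1}s_cat cat_uniq /u mem_cat negb_or /= negb_or -!andbA.
by case/and5P => _ -> _ -> _.
Qed.

Let u_ne y : y \in u -> y != e.
Proof. by move=> yu; apply: contraNneq e_notin_u => <-. Qed.

Lemma size_delete_point : size delete_point = (size s).-1.
Proof. by rewrite size_map size_u. Qed.

Lemma delete_point_perm : is_perm delete_point.
Proof.
have uq : uniq delete_point.
  rewrite map_inj_in_uniq // => x y /u_ne xe /u_ne ye.
  by have := unshift_lt xe ye; have := unshift_lt ye xe; lia.
apply: uniq_perm => //; first exact: iota_uniq.
apply: (fun h h' => (uniq_min_size uq h h').2) => [x|]; last by rewrite size_iota.
case/mapP => y yu ->; rewrite mem_iota add0n size_delete_point /=.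
have yL : y < size s.
  by have := mem_subseq u_subseq yu; rewrite (perm_mem s_perm) mem_iota.
have eL : e < size s by exact: perm_nth_lt.
by have := u_ne yu; rewrite /unshift; case: (ltnP e y); lia.
Qed.

Lemma delete_point_contained : contained delete_point s.
Proof.
exists u; split=> //; split=> [|i j]; rewrite size_map // => iu ju.
by rewrite !(nth_map 0) // unshift_lt //; apply/u_ne/mem_nth.
Qed.

Lemma nth_delete_point x : x < size s -> x != d ->
  nth 0 delete_point (unshift d x) = unshift e (nth 0 s x).
Proof.
move=> xs xd; have lt : unshift d x < size u by rewrite size_u /unshift; case: (ltnP d x); lia.
rewrite (nth_map 0) //; congr unshift; rewrite nth_cat size_take ds /unshift.
have [dx|dx] := ltnP d x.
  rewrite (_ : x.-1 < d = false); last by lia.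
  by rewrite nth_drop; congr nth; lia.
by rewrite (_ : x < d) ?nth_take //; lia.
Qed.

Lemma nth_ne x : x < size s -> x != d -> nth 0 s x != e.
Proof. by move=> xs xd; apply: contra_neq xd; exact: perm_nth_inj. Qed.

Definition pull_line c := if c <= d then c else c.+1.

End Deletion.

(** The last line is set by hand: if [d] is the last position, [pull_line] would leave it at
    [size s - 1]. *)
Definition pull_lines (s : seq nat) d m (v : nat -> nat) i :=
  if i == m then size s else pull_line d (v i).

Lemma pull_linesP (s : seq nat) d m (v : nat -> nat) : 0 < m -> d < size s ->
  v 0 = 0 -> v m = (size s).-1 -> (forall k, k < m -> v k <= v k.+1) ->
  [/\ pull_lines s d m v 0 = 0, pull_lines s d m v m = size s &
      forall k, k < m -> pull_lines s d m v k <= pull_lines s d m v k.+1] /\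
  forall k x, k < m -> x < size s -> x != d ->
    pull_lines s d m v k <= x < pull_lines s d m v k.+1 -> v k <= unshift d x < v k.+1.
Proof.
move=> m0 ds v0 vm vmono; split; first split.
- by rewrite /pull_lines eq_sym (gtn_eqF m0) v0 /pull_line.
- by rewrite /pull_lines eqxx.
- move=> k km; rewrite /pull_lines (ltn_eqF km) /pull_line; have := vmono k km.
  case: eqP => [->|_]; first by rewrite vm; case: (leqP (v k) d); lia.
  by case: (leqP (v k) d); case: (leqP (v k.+1) d); lia.
move=> k x km xs xd; rewrite /pull_lines (ltn_eqF km) /pull_line /unshift.
case: eqP => [->|_]; first by rewrite vm; case: (leqP (v k) d); case: (ltnP d x); lia.
by case: (leqP (v k) d); case: (leqP (v k.+1) d); case: (ltnP d x); lia.
Qed.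

Lemma basis_gridding_except (m n : nat) (M : 'I_m -> 'I_n -> int) s d : 0 < m -> 0 < n ->
  basis (Grid M) s -> d < size s -> exists v h, gridding_except M s d v h.
Proof.
move=> m0 n0 [sp [_ bs]] ds.
have ne : delete_point s d <> s.
  by move=> /(congr1 size); rewrite size_delete_point //; lia.
have [_ [v [h [[v0 vm vmono] [[h0 hn hmono] cells]]]]] :=
  bs _ (delete_point_perm sp ds) (delete_point_contained sp ds) ne.
rewrite size_delete_point // in vm hn.
have es : nth 0 s d < size s by exact: perm_nth_lt.
have [V1 V2] := pull_linesP m0 ds v0 vm vmono.
have [H1 H2] := pull_linesP n0 es h0 hn hmono.
exists (pull_lines s d m v), (pull_lines s (nth 0 s d) n h); split=> //; split=> // i j.
set I := (fun x => _).
have IP x : I x -> [/\ x < size s, x != d & (unshift d x < size (delete_point s d)) &&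
    (v i <= unshift d x < v i.+1) && (h j <= nth 0 (delete_point s d) (unshift d x) < h j.+1)].
  move=> /and3P[xd /andP[xs vx] hx]; split=> //.
  rewrite size_delete_point // nth_delete_point // V2 // H2 ?andbT //.
  - by rewrite /unshift; case: (ltnP d x); lia.
  - exact: perm_nth_lt.
  - exact: nth_ne.
have [c0 c1 c2] := cells i j.
split.
- by move=> /c0 no x; apply/negP => /IP[_ _ ic]; have := no (unshift d x); rewrite ic.
- move=> /c1 mono x y /IP[xs xd ix] /IP[ys yd iy] xy.
  rewrite -(unshift_lt (nth_ne sp ds xs xd) (nth_ne sp ds ys yd)) -!nth_delete_point //.
  by apply: mono => //; rewrite unshift_lt.
- move=> /c2 mono x y /IP[xs xd ix] /IP[ys yd iy] xy.
  rewrite -(unshift_lt (nth_ne sp ds ys yd) (nth_ne sp ds xs xd)) -!nth_delete_point //.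
  by apply: mono => //; rewrite unshift_lt.
Qed.

(** * The generic ultrafilter and the conclusion *)

Lemma not_finitely_based (C : seq nat -> Prop) : ~ finitely_based C ->
  forall N, exists s, basis C s /\ N < size s.
Proof.
move=> nfb N; apply: contrapT => no; apply: nfb.
exists (flatten [seq permutations (iota 0 k) | k <- iota 0 N.+1]) => s bs.
have sN : size s <= N by rewrite leqNgt; apply/negP => Ns; apply: no; exists s.
apply/flatten_mapP; exists (size s); first by rewrite mem_iota add0n ltnS.
by rewrite mem_permutations; case: bs.
Qed.

(* The ultrafilter makes the index [d] of the deleted point differ from every value that is
   determined by [k] alone. *)
Lemma generic_ultrafilter (L : nat -> nat) : (forall k, k < L k) ->
  exists U : ultrafilter (nat * nat), (\ae_ U w, w.2 < L w.1) /\
    forall a : nat -> nat, \ae_ U w, a w.1 != w.2.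
Proof.
move=> kL.
(* Sets that miss at most [N] of the admissible [d] over each [k], with [N] uniform in [k]. They are
   nonempty, because over [k = N] there are more than [N] admissible [d]. *)
pose F (A : nat * nat -> Prop) := exists N (S : nat -> seq nat),
  (forall k, size (S k) <= N) /\ forall k d, d < L k -> d \notin S k -> A (k, d).
have FF : ProperFilter F.
  split.
    move=> [N [S [SN /(_ N) no]]].
    have [d dL dS] : exists2 d, d < L N & d \notin S N.
      apply: contrapT => nd; have : L N <= size (S N).
        rewrite -(size_iota 0 (L N)); apply: uniq_leq_size; first exact: iota_uniq.
        move=> d; rewrite mem_iota add0n => dL; apply/negPn/negP => dS.
        by apply: nd; exists d.
      by have := kL N; have := SN N; lia.
    exact: no d dL dS.
  split.
  - by exists 0, (fun=> [::]).
  - move=> A B [N [S [SN h]]] [N' [S' [SN' h']]].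
    exists (N + N'), (fun k => S k ++ S' k); split=> [k|k d dL].
      by rewrite size_cat leq_add.
    by rewrite mem_cat negb_or => /andP[dS dS']; split; [apply: h|apply: h'].
  - move=> A B AB [N [S [SN h]]]; exists N, S; split=> // k d dL dS.
    by apply: AB; apply: h.
have [G [GU FG]] := ultraFilterLemma FF.
exists (Ultrafilter GU); split.
  by apply: FG; exists 0, (fun=> [::]).
move=> a; apply: FG; exists 1, (fun k => [:: a k]); split=> // k d _.
by rewrite inE eq_sym.
Qed.

Theorem theorem5p1 (m n : nat) (M : 'I_m -> 'I_n -> int) :
  gridding_matrix M -> unicyclic M -> finitely_based (Grid M).
Proof.
move=> gM uM; apply: contrapT => /not_finitely_based nfb.
have [p pP] := choice nfb.
(* Any edge of the cycle supplies a column and a row. *)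
have [m0 n0] : 0 < m /\ 0 < n.
  have [C [[q [_ sq cq _]] _]] := uM.
  case: q sq cq => [//|a [//|b q]] _ /= /andP[ab _].
  have pos N (i : 'I_N) : 0 < N by exact: leq_ltn_trans (leq0n i) (ltn_ord i).
  by case: a b ab => [i|j] [i'|j'] //= _; [split; [exact: pos i|exact: pos j']|split; [exact: pos i'|exact: pos j]].
have lines (kd : nat * nat) : exists vh : (nat -> nat) * (nat -> nat),
    kd.2 < size (p kd.1) -> gridding_except M (p kd.1) kd.2 vh.1 vh.2.
  have [lt|_] := ltnP kd.2 (size (p kd.1)); last by exists (id, id).
  by have [v [h g]] := basis_gridding_except m0 n0 (pP kd.1).1 lt; exists (v, h).
have [vh vhP] := choice lines.
have [U [dL dgen]] := generic_ultrafilter (fun k => (pP k).2).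
have p_perm k : is_perm (p k) by have [[]] := pP k.
have ge : \ae_ U w, gridding_except M (p w.1) w.2 (vh w).1 (vh w).2.
  by apply: filterS dL => w; exact: vhP.
have [w gw] := ae_ex (limit_gridding (d := snd) gM p_perm dgen ge uM).
by have [[_ []]] := pP w.1.
Qed.
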